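(* Let $T=F_1\cdots F_M$ be a positive bidiagonal factorization and let $a\in\mathcal A_{\mathrm{cyc}}$. Let $\mathscr H_{(a)}$ be the height-ordered matrix built from the minimum-height refactorization of $T_{(a)}$. (1) $\mathscr H_{(a)}$ has only the two block displacements $+Q$ and $-P$: every height $h\in\mathbb N_0$ carries exactly $d$ coordinates; the block from height $h$ to height $h+Q$ is a $d\times d$ permutation matrix; for $h\ge P$ the block from height $h$ to height $h-P$ has exactly one nonzero entry in each row and each column, and these entries are strictly positive; all other blocks are zero. (2) Let $\mathsf R_a$ be the coordinate projection onto all coordinates belonging to the first factor position of this refactorization. Then, as a formal power-series identity in $\tau$, \[ \mathsf R_a(I-\tau\mathscr H_{(a)})^{-1}\mathsf R_a^{\mathsf T}=(I-\tau^MT_{(a)})^{-1}. \] If the matrices involved define bounded operators, the same identity holds on the common operator-resolvent domain. (3) Consequently, grouping consecutive heights of $\mathscr H_{(a)}$ into finite blocks and applying Schur complementation gives a height-block continued fraction: with $w=\max(P,Q)$ and height blocks $\mathscr V^{(a)}_m$ consisting of the coordinates of heights $mw\le h<(m+1)w$, the matrix $\mathscr H_{(a)}$ is block tridiagonal with diagonal blocks $\mathsf A_m$, superdiagonal blocks $\mathsf B_m$ (rows $\mathscr V^{(a)}_m$, columns $\mathscr V^{(a)}_{m+1}$) and subdiagonal blocks $\mathsf C_m$ (rows $\mathscr V^{(a)}_{m+1}$, columns $\mathscr V^{(a)}_m$), and the leading blocks $\Phi_m(\tau)$ (rows and columns $\mathscr V_m^{(a)}$) of the formal resolvents of the tails of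 $\mathscr H_{(a)}$ on $\bigcup_{k\ge m}\mathscr V^{(a)}_k$ satisfy \[ \Phi_m(\tau)=\bigl(I-\tau\mathsf A_m-\tau^2\mathsf B_m\Phi_{m+1}(\tau)\mathsf C_m\bigr)^{-1},\qquad m\in\mathbb N_0; \] the $\mathsf R_a$-projection of the resolvent of $\mathscr H_{(a)}$ recovers the resolvent of $T_{(a)}$ through the identity in (2). (4) Whenever $T_{(a)}$ is supplied with mixed-type Favard data, i.e. nonsingular matrices $\xi\in\mathbb C^{q\times q}$, $\nu\in\mathbb C^{p\times p}$ and a $q\times p$ matrix of finite measures $\mathrm d\Psi$ with $\xi^{-1}\mathsf E_{[q]}T_{(a)}^n\mathsf E_{[p]}^{\mathsf T}\nu^{-\mathsf T}=\int x^n\,\mathrm d\Psi(x)$ for all $n\in\mathbb N_0$, the corresponding rectangular projection gives simultaneous rational approximants to its Weyl matrix: for $z^{-1}=\tau^M$ and $N$ large enough, the rational matrices \[ \frac1z\,\xi^{-1}\mathsf E_{[q]}\mathsf R_a\bigl(I-\tau\mathscr H_{(a)}^{[0,N]}\bigr)^{-1}\mathsf R_a^{\mathsf T}\mathsf E_{[p]}^{\mathsf T}\nu^{-\mathsf T} \] have expansions at $z=\infty$ that agree with $\sum_{n\ge0}z^{-n-1}\int x^n\,\mathrm d\Psi(x)$ up to an order that tends to infinity with $N$, where $\mathscr H_{(a)}^{[0,N]}$ is the principal submatrix of $\mathscr H_{(a)}$ on $\mathscr V^{(a)}_0\cup\dots\cup\mathscr V^{(a)}_N$.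
   Context: Let $p,q\ge1$, $M=p+q$, $d=\gcd(p,q)$, $P=p/d$, $Q=q/d$, $R=P+Q$. Matrices are semi-infinite, indexed by $\mathbb N_0$ unless stated otherwise. A lower bidiagonal $L$ is normalized if $L_{n,n}=1$ (coefficients $L_{n+1,n}$), an upper bidiagonal $U$ is normalized if $U_{n,n+1}=1$ (coefficients $U_{n,n}$), and positive means all coefficients are $>0$. In a positive bidiagonal factorization $T=L_1\cdots L_pU_q\cdots U_1$ all factors are normalized positive bidiagonal; $F_a=L_a$ ($1\le a\le p$), $F_{p+b}=U_{q-b+1}$ ($1\le b\le q$), $T_{(a)}=F_a\cdots F_MF_1\cdots F_{a-1}$. $\mathsf E_{[r]}=[\,I_r\ 0\ 0\cdots]$ is the projection onto the first $r$ coordinates. Selected indices: $\mathcal A_{\mathrm{cyc}}=\{a_-,\dots,a_+\}$ with $a_-=p-\lceil P/Q\rceil+1$, $a_+=p+1+\min\{q-1,\lceil Q/P\rceil\}$. Let $r_k\in\{0,\dots,R-1\}$ be the remainder of $kQ$ mod $R$, and $\sigma_{\mathrm{min}}$ the word of length $M$ with $(k+1)$-st letter $L$ if $r_k<P$ and $U$ if $r_k\ge P$, $0\le k\le M-1$. For $a\in\mathcal A_{\mathrm{cyc}}$, finitely many replacements of a neighbouring pair $U,L$ (upper before lower) by the unique normalized positive pair $\widetilde L,\widetilde U$ with $UL=\widetilde L\widetilde U$ transform the list $(F_a,\dots,F_M,F_1,\dots,F_{a-1})$ into a list $(\widetilde F^{(a)}_1,\dots,\widetilde F^{(a)}_M)$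 of normalized positive bidiagonal matrices with type word $\sigma_{\mathrm{min}}$; the result does not depend on the replacements chosen, and $T_{(a)}=\widetilde F^{(a)}_1\cdots\widetilde F^{(a)}_M$. This is the minimum-height refactorization. Matrix $\mathscr H_{(a)}$: put $\widetilde\omega_j=r_{j-1}$ for $j\in\{1,\dots,M\}$. Rows and columns are indexed by pairs $(h,j)$ with $h\in\mathbb N_0$, $j\in\{1,\dots,M\}$, $h-\widetilde\omega_j\in R\mathbb N_0$, ordered by $h$ (the height) and then by $j$ (the factor position); put $n=(h-\widetilde\omega_j)/R$, and $j^+=j+1$ for $j<M$, $M^+=1$. The nonzero entries are: $1$ at row $(h,j)$, column $(h+Q,j^+)$; if $\widetilde F^{(a)}_j$ is lower and $n\ge1$, the entry $(\widetilde F^{(a)}_j)_{n,n-1}$ at row $(h,j)$, column $(h-P,j^+)$; if $\widetilde F^{(a)}_j$ is upper, the entry $(\widetilde F^{(a)}_j)_{n,n}$ at row $(h,j)$, column $(h-P,j^+)$. The projection $\mathsf R_a$ selects the coordinates $(h,1)$, ordered by $n$, and thus takes values in sequences indexed by $n\in\mathbb N_0$. Formal resolvents are Neumann series in $\tau$, computed coefficient by coefficient. *)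

(* Defs.v *)
Set Warnings "-notation-overridden,-notation-incompatible-prefix,-ambiguous-paths".
From mathcomp Require Export all_boot all_order all_algebra.
From mathcomp Require Export complex.
From mathcomp Require Export all_classical all_reals all_analysis.

Set Implicit Arguments.
Unset Strict Implicit.
Unset Printing Implicit Defensive.

Import Order.TTheory GRing.Theory Num.Theory numFieldNormedType.Exports.

Local Open Scope classical_set_scope.
Local Open Scope ring_scope.

Section Matrices.
Variable R : realType.
Local Notation C := R[i].

(* Matrices with arbitrary index types. In a product the inner sum is the
   finitely supported sum of the library; every product formed below has only
   finitely many nonzero terms in each entry. *)
Definition gmx (I J : Type) := I -> J -> C.

Definition gzero (I J : Type) : gmx I J := fun _ _ => 0.

Definition gone (I : eqType) : gmx I I := fun i j => (i == j)%:R.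

Definition gtr (I J : Type) (A : gmx I J) : gmx J I := fun j i => A i j.

Definition gmul (I : Type) (J : choiceType) (K : Type)
    (A : gmx I J) (B : gmx J K) : gmx I K :=
  fun i k => \sum_(j \in [set: J]) A i j * B j k.

Definition gpow (I : choiceType) (A : gmx I I) (n : nat) : gmx I I :=
  iter n (gmul A) (@gone I).

Definition gprod (I : choiceType) (s : seq (gmx I I)) : gmx I I :=
  foldr (@gmul I I I) (@gone I) s.

Definition gapply (I : Type) (J : choiceType) (A : gmx I J) (x : J -> C) :
    I -> C :=
  fun i => \sum_(j \in [set: J]) A i j * x j.

(* E_[r] = [I_r 0 0 ...] *)
Definition Eproj (r : nat) : gmx 'I_r nat := fun i n => (i == n :> nat)%:R.

(* Formal power series in tau with matrix coefficients: X n is the coefficient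
   of tau^n. *)
Definition fps (I J : Type) := nat -> gmx I J.

Definition fps_mono (I J : Type) (m : nat) (A : gmx I J) : fps I J :=
  fun n => if n == m then A else @gzero I J.

Definition fps_add (I J : Type) (X Y : fps I J) : fps I J :=
  fun n i j => X n i j + Y n i j.

Definition fps_mul (I : Type) (J : choiceType) (K : Type)
    (X : fps I J) (Y : fps J K) : fps I K :=
  fun n i k => \sum_(l < n.+1) gmul (X l) (Y (n - l)%N) i k.

Definition fps_pow (I : choiceType) (X : fps I I) (k : nat) : fps I I :=
  iter k (fps_mul X) (fps_mono 0 (@gone I)).

(* (I - X)^-1 = \sum_k X^k for a series X without constant term; X^k then
   contributes nothing to the coefficient of tau^n when k > n. *)
Definition neumann (I : choiceType) (X : fps I I) : fps I I :=
  fun n i j => \sum_(k < n.+1) fps_pow X k n i j.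

(* The order of R[i] is partial: 0 < z means that z is real and positive. *)
Definition pos_lower (A : gmx nat nat) : Prop :=
  [/\ forall n, A n n = 1, forall n, 0 < A n.+1 n
    & forall n m, n != m -> n != m.+1 -> A n m = 0].

Definition pos_upper (A : gmx nat nat) : Prop :=
  [/\ forall n, 0 < A n n, forall n, A n n.+1 = 1
    & forall n m, n != m -> m != n.+1 -> A n m = 0].

(* Letters of type words: true for L (lower), false for U (upper). *)
Definition of_type (b : bool) (A : gmx nat nat) : Prop :=
  if b then pos_lower A else pos_upper A.

Definition has_type_word (w : seq bool) (s : seq (gmx nat nat)) : Prop :=
  size s = size w /\
  forall j, (j < size w)%N ->
    of_type (nth false w j) (nth (@gzero nat nat) s j).

Inductive UL_step : seq (gmx nat nat) -> seq (gmx nat nat) -> Prop :=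
| UL_swap (s1 s2 : seq (gmx nat nat)) (U L L' U' : gmx nat nat) :
    pos_upper U -> pos_lower L -> pos_lower L' -> pos_upper U' ->
    gmul U L =2 gmul L' U' ->
    UL_step (s1 ++ [:: U, L & s2]) (s1 ++ [:: L', U' & s2]).

Inductive UL_steps (s : seq (gmx nat nat)) : seq (gmx nat nat) -> Prop :=
| UL_refl : UL_steps s s
| UL_trans s' s'' : UL_steps s s' -> UL_step s' s'' -> UL_steps s s''.

Section BoundedOperators.
Local Open Scope ereal_scope.

(* The norm of l^e(I) for 1 <= e <= +oo. *)
Definition lnorm (I : choiceType) (e : \bar R) (x : I -> C) : \bar R :=
  match e with
  | r%:E => (\esum_(i in [set: I]) ((complex.Re `|x i|) `^ r)%R%:E) `^ r^-1
  | +oo => ereal_sup [set (complex.Re `|x i|)%R%:E | i in [set: I]]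
  | -oo => 0
  end.

Definition in_l (I : choiceType) (e : \bar R) (x : I -> C) : Prop :=
  lnorm e x < +oo.

Definition bounded_map (I J : choiceType) (e : \bar R)
    (G : (J -> C) -> (I -> C)) : Prop :=
  exists c : R, forall x, in_l e x -> lnorm e (G x) <= c%:E * lnorm e x.

End BoundedOperators.

Definition bounded_mx (I J : choiceType) (e : \bar R) (A : gmx I J) : Prop :=
  bounded_map e (gapply A).

(* G is the bounded inverse of I - t A on l^e(I); so t belongs to the
   operator-resolvent domain of A exactly when such a G exists. *)
Definition op_resolvent (I : choiceType) (e : \bar R) (A : gmx I I) (t : C)
    (G : (I -> C) -> (I -> C)) : Prop :=
  let S (x : I -> C) : I -> C := fun i => x i - t * gapply A x i in
  bounded_map e G /\
  forall x, in_l e x -> G (S x) =1 x /\ S (G x) =1 x.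

(* A complex finite measure
   (re_pos - re_neg) + i (im_pos - im_neg) on the real line; the nonnegative
   finite measures are those whose last three components vanish. *)
Record cmeasure := CMeasure {
  re_pos : {finite_measure set (measurableTypeR R) -> \bar R};
  re_neg : {finite_measure set (measurableTypeR R) -> \bar R};
  im_pos : {finite_measure set (measurableTypeR R) -> \bar R};
  im_neg : {finite_measure set (measurableTypeR R) -> \bar R} }.

Definition has_moment (mu : cmeasure) (n : nat) : Prop :=
  let f : measurableTypeR R -> \bar R := fun x => (x ^+ n)%:E in
  [/\ (re_pos mu).-integrable setT f, (re_neg mu).-integrable setT f,
      (im_pos mu).-integrable setT f & (im_neg mu).-integrable setT f].

Definition moment (mu : cmeasure) (n : nat) : C :=
  let f : measurableTypeR R -> R := fun x => x ^+ n in
  Complex (Rintegral (re_pos mu) setT f - Rintegral (re_neg mu) setT f)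
          (Rintegral (im_pos mu) setT f - Rintegral (im_neg mu) setT f).

End Matrices.

Arguments gone {R I}.
Arguments Eproj {R} r.

(* The integer ceiling of x / y, for y > 0. *)
Definition ceildiv (x y : nat) : nat := ((x + y).-1 %/ y)%N.

Section Cyclic.
Variables p q : nat.

Definition dd := gcdn p q.
Definition PP := (p %/ dd)%N.
Definition QQ := (q %/ dd)%N.
Definition RR := (PP + QQ)%N.

Definition a_minus : nat := (p - ceildiv PP QQ + 1)%N.
Definition a_plus : nat := (p + 1 + minn (q - 1) (ceildiv QQ PP))%N.
Definition A_cyc (a : nat) : bool := (a_minus <= a <= a_plus)%N.

Definition rem (k : nat) : nat := (k * QQ %% RR)%N.

Definition sigma_min : seq bool := [seq (rem k < PP)%N | k <- iota 0 (p + q)].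

(* Factor positions are numbered from 0, so omega-tilde of position j is rem j. *)
Definition hvalid (x : nat * 'I_(p + q)) : bool :=
  (rem x.2 <= x.1)%N && (RR %| x.1 - rem x.2)%N.

Definition hidx := {x : nat * 'I_(p + q) | hvalid x}.

Definition height (x : hidx) : nat := (val x).1.
Definition hpos (x : hidx) : 'I_(p + q) := (val x).2.
Definition hnum (x : hidx) : nat := ((height x - rem (hpos x)) %/ RR)%N.

Definition coords (h : nat) := {j : 'I_(p + q) | hvalid (h, j)}.

Definition coord_hidx (h : nat) (j : coords h) : hidx :=
  exist _ (h, val j) (valP j).

Definition width : nat := maxn PP QQ.

Definition vblock (m : nat) :=
  {x : hidx | (m * width <= height x)%N && (height x < m.+1 * width)%N}.

Definition tail (m : nat) := {x : hidx | (m * width <= height x)%N}.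

Definition vblock_tail (m : nat) (x : vblock m) : tail m :=
  exist _ (val x) (proj1 (andP (valP x))).

(* The coordinates of V_0, ..., V_N; the enumeration of this finite type is
   lexicographic, i.e. by height and then by position. *)
Definition trunc (N : nat) :=
  {x : 'I_(N.+1 * width) * 'I_(p + q) | hvalid (x.1 : nat, x.2)}.

Definition trunc_hidx (N : nat) (x : trunc N) : hidx :=
  exist _ ((val x).1 : nat, (val x).2) (valP x).

Section Matrix.
Variable R : realType.
Local Notation C := R[i].

(* F_1, ..., F_M *)
Definition factors (L U : nat -> gmx R nat nat) : seq (gmx R nat nat) :=
  [seq L a | a <- iota 1 p] ++ [seq U (q - b + 1)%N | b <- iota 1 q].

Definition pos_bidiag_factorization (T : gmx R nat nat)
    (L U : nat -> gmx R nat nat) : Prop :=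
  [/\ forall a, (1 <= a <= p)%N -> pos_lower (L a),
      forall b, (1 <= b <= q)%N -> pos_upper (U b)
    & T =2 gprod (factors L U)].

(* F_a, ..., F_M, F_1, ..., F_(a-1) *)
Definition cyc_factors (L U : nat -> gmx R nat nat) (a : nat) :
    seq (gmx R nat nat) :=
  rot a.-1 (factors L U).

Definition T_cyc (L U : nat -> gmx R nat nat) (a : nat) : gmx R nat nat :=
  gprod (cyc_factors L U a).

Definition min_height_refactorization (L U : nat -> gmx R nat nat) (a : nat)
    (Ft : seq (gmx R nat nat)) : Prop :=
  UL_steps (cyc_factors L U a) Ft /\ has_type_word sigma_min Ft.

Definition Hmx (Ft : seq (gmx R nat nat)) : gmx R hidx hidx :=
  fun x y =>
    let F := nth (@gzero R nat nat) Ft (hpos x) in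
    let n := hnum x in
    if hpos y != ordS (hpos x) then 0
    else if height y == (height x + QQ)%N then 1
    else if (height y + PP)%N == height x then
      if nth false sigma_min (hpos x)
      then (if (1 <= n)%N then F n n.-1 else 0)
      else F n n
    else 0.

(* The projection onto the coordinates of the first factor position. *)
Definition Ra : gmx R nat hidx :=
  fun n x => ((hpos x == 0%N :> nat) && (hnum x == n))%:R.

Definition hblock (H : gmx R hidx hidx) (h h' : nat) :
    'M[C]_(#|{: coords h}|, #|{: coords h'}|) :=
  \matrix_(i, k) H (coord_hidx (enum_val i)) (coord_hidx (enum_val k)).

Definition two_displacements (H : gmx R hidx hidx) : Prop :=
  exists e : (forall h, #|{: coords h}| = dd),
  [/\ forall h, is_perm_mx (castmx (e h, e (h + QQ)%N) (hblock H h (h + QQ)%N)),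
      forall h, (PP <= h)%N ->
        let B := hblock H h (h - PP)%N in
        [/\ forall i, exists! k, B i k != 0,
            forall k, exists! i, B i k != 0
          & forall i k, B i k != 0 -> 0 < B i k]
    & forall h h', h' <> (h + QQ)%N -> h <> (h' + PP)%N -> hblock H h h' = 0].

Definition formal_resolvent (I : choiceType) (A : gmx R I I) : fps R I I :=
  neumann (fps_mono 1 A).

Definition formal_projection (H : gmx R hidx hidx) (T : gmx R nat nat) : Prop :=
  forall n, gmul Ra (gmul (formal_resolvent H n) (gtr Ra))
              =2 neumann (fps_mono (p + q) T) n.

(* The sequence spaces l^e, 1 <= e <= +oo, are all admitted. *)
Definition operator_projection (H : gmx R hidx hidx) (T : gmx R nat nat) :
    Prop :=
  forall e : \bar R, (1 <= e)%E -> bounded_mx e H -> bounded_mx e T ->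
  forall (t : C) G S,
    op_resolvent e H t G -> op_resolvent e T (t ^+ (p + q)) S ->
  forall y, in_l e y -> gapply Ra (G (gapply (gtr Ra) y)) =1 S y.

Definition block_tridiagonal (H : gmx R hidx hidx) : Prop :=
  forall m m' (x : vblock m) (y : vblock m'),
    ~~ ((m <= m'.+1)%N && (m' <= m.+1)%N) -> H (val x) (val y) = 0.

Definition vblock_mx (H : gmx R hidx hidx) (m m' : nat) :
    gmx R (vblock m) (vblock m') :=
  fun x y => H (val x) (val y).
Arguments vblock_mx H m m' x y : clear implicits.

Definition tail_mx (H : gmx R hidx hidx) (m : nat) : gmx R (tail m) (tail m) :=
  fun x y => H (val x) (val y).
Arguments tail_mx H m x y : clear implicits.

Definition Phi (H : gmx R hidx hidx) (m : nat) : fps R (vblock m) (vblock m) :=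
  fun n x y => formal_resolvent (tail_mx H m) n (vblock_tail x) (vblock_tail y).
Arguments Phi H m n x y : clear implicits.

Definition continued_fraction (H : gmx R hidx hidx) : Prop :=
  let A m := vblock_mx H m m in
  let B m := vblock_mx H m m.+1 in
  let Cs m := vblock_mx H m.+1 m in
  forall m n,
    Phi H m n =2
    neumann
      (fps_add (fps_mono 1 (A m))
         (fps_mul (fps_mono 2 (B m))
            (fps_mul (Phi H m.+1) (fps_mono 0 (Cs m))))) n.

Definition favard_data (T : gmx R nat nat) (xi : 'M[C]_q) (nu : 'M[C]_p)
    (Psi : 'I_q -> 'I_p -> cmeasure R) : Prop :=
  [/\ xi \in unitmx, nu \in unitmx,
      forall i j n, has_moment (Psi i j) n
    & forall n,
        invmx xi
          *m (\matrix_(i, j)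
                gmul (Eproj q) (gmul (gpow T n) (gtr (Eproj p))) i j)
          *m (invmx nu)^T
        = \matrix_(i, j) moment (Psi i j) n].

(* The field of rational functions of tau over the complex numbers. *)
Definition ratfun := {fraction {poly C}}.
Definition ratC (c : C) : ratfun := tofrac c%:P.
Definition tau : ratfun := tofrac 'X.
Definition zvar : ratfun := tau ^- (p + q).

Definition trunc_mx (H : gmx R hidx hidx) (N : nat) : 'M[C]_#|{: trunc N}| :=
  \matrix_(i, k) H (trunc_hidx (enum_val i)) (trunc_hidx (enum_val k)).

(* E_[r] R_a, restricted to the coordinates of V_0, ..., V_N *)
Definition trunc_ERa (r N : nat) : 'M[C]_(r, #|{: trunc N}|) :=
  \matrix_(i, k) gmul (Eproj r) Ra i (trunc_hidx (enum_val k)).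

Definition approximant (H : gmx R hidx hidx) (xi : 'M[C]_q) (nu : 'M[C]_p)
    (N : nat) : 'M[ratfun]_(q, p) :=
  zvar^-1 *:
    (map_mx ratC (invmx xi *m trunc_ERa q N)
       *m invmx (1%:M - tau *: map_mx ratC (trunc_mx H N))
       *m map_mx ratC ((trunc_ERa p N)^T *m (invmx nu)^T)).

(* f = \sum_(n < K) c_n z^(-n-1) + O(z^(-K-1)) at z = oo, f being a rational
   function of z: the remainder is a quotient a(z) / b(z) of polynomials with
   deg a + K + 1 <= deg b (or a = 0). *)
Definition agrees_at_infinity (f : ratfun) (c : nat -> C) (K : nat) : Prop :=
  exists a b : {poly C},
    [/\ b != 0, (size a + K < size b)%N
      & f - \sum_(n < K) zvar ^- n.+1 * ratC (c n)
        = (map_poly ratC a).[zvar] / (map_poly ratC b).[zvar]].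

Definition rational_approximation (H : gmx R hidx hidx) (T : gmx R nat nat) :
    Prop :=
  forall (xi : 'M[C]_q) (nu : 'M[C]_p) (Psi : 'I_q -> 'I_p -> cmeasure R),
    favard_data T xi nu Psi ->
  exists (N0 : nat) (ord : nat -> nat),
    ord @ \oo --> \oo /\
    forall N, (N0 <= N)%N -> forall i j,
      agrees_at_infinity (approximant H xi nu N i j)
        (moment (Psi i j)) (ord N).

End Matrix.
End Cyclic.

Arguments Hmx p q {R} Ft.

(* Main.v *)
From HB Require Import structures.
Require Import Defs.
From mathcomp Require perm.
From mathcomp Require Import zify.

(** Write F_1, ..., F_M for the refactorized list and index a coordinate (h, j)
    of the height-ordered matrix H by its position j and its number
    n = (h - r_j) / R, with R = P + Q.  In these coordinates H is nothing but the cyclic block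
    shift that sends position j to position j + 1 through the matrix F_j
    ([Hmx_coord_at]).  Indeed, a step j -> j + 1 adds Q to the residue r_j, without
    carry modulo R when the letter is L and with a carry when it is U.  The two
    displacements +Q and -P therefore change n by 0 and -1 for a lower factor,
    and by +1 and 0 for an upper factor: these are the diagonals of F_j.

    Part (1) is then arithmetic modulo R: Q is invertible modulo R, so every
    residue is taken by exactly d = M / R positions ([card_coords]), and the
    cyclic successor is a bijection between the positions at heights h and
    h + Q, as well as at heights h and h - P.

    Part (2) follows by going once round the cycle.  The n-th power of H,
    compressed to the first position, vanishes unless M divides n, and is then
    the power n / M of F_1 ... F_M ([gpow_Hmx_cycle]); this product is T_(a)
    because each replacement UL = L'U' preserves it ([UL_steps_gprod]).  For
    bounded operators the same cycle is followed inside the linear system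
    (I - t H) x = y: eliminating the positions other than the first one leaves
    (I - t^M T_(a)) x_1 = y_1 ([cycle_elimination]), an argument which is valid
    on the whole common resolvent domain since no series is summed.

    Part (3) is the Schur complement for formal resolvents
    ([schur_complement]).  Since displacements are at most w in absolute value,
    a height block only communicates with its two neighbours, which reduces the
    couplings with the remaining tail to those with the next block.

    Part (4): a path of n steps climbs by at most n Q, so that powers of the
    truncation agree with those of H as long as the path stays below the cut
    ([trunc_mx_pow]).  The truncation A is still a cyclic shift of positions,
    hence its resolvent between vectors living at the first position equals
    that of A^M at tau^M ([cyclic_resolvent]); this makes the approximants
    rational functions of z = tau^-M, of the form u (z - A^M)^-1 v, whose
    expansion at infinity has the coefficients u (A^M)^n v
    ([resolvent_at_infinity]).  The latter are the moments for all n up to a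
    bound growing linearly with N. *)

Set Implicit Arguments.
Unset Strict Implicit.
Unset Printing Implicit Defensive.
Import Order.TTheory GRing.Theory Num.Theory numFieldNormedType.Exports.
Local Open Scope classical_set_scope.
Local Open Scope ring_scope.

(** * Row-finite matrices and formal Neumann series *)

Section FiniteSupport.
Variable V : nmodType.

Lemma fsum_seq (I : choiceType) (s : seq I) (f : I -> V) :
  uniq s -> (forall i, i \notin s -> f i = 0) ->
  \sum_(i \in [set: I]) f i = \sum_(i <- s) f i.
Proof.
move=> us f0; rewrite (@fsbigE _ _ _ _ setT s)// => [|i _]; last exact: f0.
by apply: eq_bigl => i; rewrite in_setT.
Qed.

Lemma fsum_embed (I J : choiceType) (h : J -> I) (f : I -> V) :
  injective h -> (forall i, (forall j, h j <> i) -> f i = 0) ->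
  \sum_(i \in [set: I]) f i = \sum_(j \in [set: J]) f (h j).
Proof.
move=> hinj f0; rewrite -(@fsbig_image _ _ _ _ _ setT h); last first.
  by move=> x y _ _; exact: hinj.
apply/esym/fsbig_widen => // i [_ /= hi]; apply: f0 => j hj; apply: hi.
by exists j.
Qed.

Lemma fsum_single (I : choiceType) (i0 : I) (f : I -> V) :
  (forall i, i != i0 -> f i = 0) -> \sum_(i \in [set: I]) f i = f i0.
Proof.
move=> f0; rewrite (@fsum_seq _ [:: i0]) ?big_seq1// => i.
by rewrite inE; exact: f0.
Qed.

End FiniteSupport.

Lemma seq_preimage (I J : choiceType) (h : J -> I) (s : seq I) :
  injective h -> exists s' : seq J, forall j, h j \in s -> j \in s'.
Proof.
move=> hinj; elim: s => [|i s [s' IH]]; first by exists [::].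
have [[j hj]|hN] := pselect (exists j, h j = i).
  exists (j :: s') => k; rewrite !inE => /orP[/eqP|/IH ->]; last by rewrite orbT.
  by rewrite -hj => /hinj ->; rewrite eqxx.
exists s' => k; rewrite inE => /orP[/eqP hk|/IH//].
by case: hN; exists k.
Qed.

Section GeneralMatrices.
Variable R : realType.
Local Notation C := R[i].
Implicit Types I J K : choiceType.

(** The entries of a product are finitely supported sums, which are set to 0 when
    the support is infinite; associativity and additivity hold as soon as the
    left factors have finite rows, so this condition is carried along. *)
Definition row_finite (I : Type) J (A : gmx R I J) :=
  forall i, exists s : seq J, forall j, j \notin s -> A i j = 0.

Lemma row_finite_uniq (I : Type) J (A : gmx R I J) i : row_finite A ->
  exists2 s : seq J, uniq s & forall j, j \notin s -> A i j = 0.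
Proof.
move=> /(_ i)[s sA]; exists (undup s); first exact: undup_uniq.
by move=> j; rewrite mem_undup; exact: sA.
Qed.

Lemma gmxP (I J : Type) (A B : gmx R I J) : A =2 B -> A = B.
Proof. by move=> AB; apply/funext => i; apply/funext => j. Qed.

Lemma eq_gmul (I : Type) J (K : Type) (A A' : gmx R I J) (B B' : gmx R J K) i k :
  (forall j, A i j = A' i j) -> (forall j, B j k = B' j k) ->
  gmul A B i k = gmul A' B' i k.
Proof. by move=> AA' BB'; apply: eq_fsbigr => j _; rewrite AA' BB'. Qed.

Lemma gmul_seq (I : Type) J (K : Type) (A : gmx R I J) (B : gmx R J K) i k s :
  uniq s -> (forall j, j \notin s -> A i j = 0) ->
  gmul A B i k = \sum_(j <- s) A i j * B j k.
Proof. by move=> us sA; apply: fsum_seq => // j /sA ->; rewrite mul0r. Qed.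

Lemma row_finite_one I : row_finite (@gone R I).
Proof.
by move=> i; exists [:: i] => j; rewrite inE eq_sym /gone => /negPf ->.
Qed.

Lemma row_finite_rows J K (B : gmx R J K) (s : seq J) : row_finite B ->
  exists2 t : seq K, uniq t & {in s, forall j k, k \notin t -> B j k = 0}.
Proof.
move=> fB; elim: s => [|j s [t _ tB]]; first by exists [::].
have [u uB] := fB j; exists (undup (u ++ t)) => [|l]; first exact: undup_uniq.
rewrite inE => ls k; rewrite mem_undup mem_cat negb_or => /andP[ku kt].
by move: ls => /orP[/eqP ->|ls]; [exact: uB|exact: tB].
Qed.

Lemma row_finite_mul (I : Type) J K (A : gmx R I J) (B : gmx R J K) :
  row_finite A -> row_finite B -> row_finite (gmul A B).
Proof.
move=> fA fB i; have [s us sA] := row_finite_uniq i fA.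
have [t _ tB] := row_finite_rows s fB; exists t => k kt.
rewrite (gmul_seq _ _ us sA) big1_seq// => j /andP[_ js].
by rewrite (tB j js k kt) mulr0.
Qed.

Lemma gmulA (I : Type) J K (L : Type) (A : gmx R I J) (B : gmx R J K)
    (D : gmx R K L) :
  row_finite A -> row_finite B -> gmul A (gmul B D) = gmul (gmul A B) D.
Proof.
move=> fA fB; apply: gmxP => i l.
have [s us sA] := row_finite_uniq i fA.
have [t ut tB] := row_finite_rows s fB.
have AB0 k : k \notin t -> gmul A B i k = 0.
  move=> kt; rewrite (gmul_seq _ _ us sA) big1_seq// => j /andP[_ js].
  by rewrite tB ?mulr0.
rewrite (gmul_seq _ _ us sA) (gmul_seq _ _ ut AB0).
under [RHS]eq_bigr do rewrite (gmul_seq _ _ us sA) mulr_suml.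
rewrite exchange_big; apply: eq_big_seq => j js.
rewrite (gmul_seq _ _ ut (tB j js)) mulr_sumr.
by apply: eq_bigr => k _; rewrite mulrA.
Qed.

Lemma gmul1 I (K : Type) (B : gmx R I K) : gmul (@gone R I) B = B.
Proof.
apply: gmxP => i k; rewrite /gmul (fsum_single (i0 := i)) /gone ?eqxx ?mul1r//.
by move=> j; rewrite eq_sym => /negPf ->; rewrite mul0r.
Qed.

Lemma gmul0 (I : Type) J (K : Type) (B : gmx R J K) :
  gmul (@gzero R I J) B = @gzero R I K.
Proof. by apply: gmxP => i k; apply: fsbig1 => j _; rewrite mul0r. Qed.

Lemma gmul_zero (I : Type) J (K : Type) (A : gmx R I J) :
  gmul A (@gzero R J K) = @gzero R I K.
Proof. by apply: gmxP => i k; apply: fsbig1 => j _; rewrite mulr0. Qed.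

Lemma gmul_sumr (I : Type) J (K : Type) (T : Type) (r : seq T)
    (A : gmx R I J) (B : T -> gmx R J K) i k : row_finite A ->
  gmul A (fun j l => \sum_(t <- r) B t j l) i k = \sum_(t <- r) gmul A (B t) i k.
Proof.
move=> /(row_finite_uniq i)[s us sA].
under [RHS]eq_bigr do rewrite (gmul_seq _ _ us sA).
rewrite (gmul_seq _ _ us sA) exchange_big; apply: eq_bigr => j _.
by rewrite mulr_sumr.
Qed.

Lemma row_finite_pow I (A : gmx R I I) n : row_finite A -> row_finite (gpow A n).
Proof.
by move=> fA; elim: n => [|n IH]; [exact: row_finite_one|exact: row_finite_mul].
Qed.

Lemma fps_mul_mono (I : Type) J (K : Type) m l (A : gmx R I J) (B : gmx R J K) :
  fps_mul (fps_mono m A) (fps_mono l B) = fps_mono (m + l) (gmul A B).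
Proof.
apply/funext => n; apply: gmxP => i k; rewrite /fps_mul /fps_mono.
case: (leqP m n) => mn; last first.
  rewrite big1 => [|[x /= xn] _].
    by case: eqP => // nm; move: mn; rewrite nm ltnNge leq_addr.
  by rewrite ifF ?gmul0//; apply/negbTE; rewrite neq_ltn (leq_ltn_trans _ mn).
rewrite (bigD1 (Ordinal (mn : (m < n.+1)%N)))//= eqxx big1 ?addr0 => [|x xm].
  have -> : (n - m == l)%N = (n == m + l)%N.
    by rewrite -(eqn_add2l m) subnKC.
  by case: ifP => // _; rewrite gmul_zero.
by rewrite ifF ?gmul0//; apply: contraNF xm => /eqP xm; apply/eqP/val_inj.
Qed.

Lemma fps_pow_mono I m (A : gmx R I I) k :
  fps_pow (fps_mono m A) k = fps_mono (k * m) (gpow A k).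
Proof. by elim: k => [|k IH] //=; rewrite IH fps_mul_mono mulSn. Qed.

Lemma neumann_mono I m (A : gmx R I I) n : (0 < m)%N ->
  neumann (fps_mono m A) n
  = if (m %| n)%N then gpow A (n %/ m) else @gzero R I I.
Proof.
move=> m0; apply: gmxP => i j; rewrite /neumann.
under eq_bigr do rewrite fps_pow_mono /fps_mono.
case: ifP => mn; last first.
  rewrite big1// => k _; rewrite ifF//; apply: contraFF mn => /eqP ->.
  exact: dvdn_mull.
have nm : (n %/ m < n.+1)%N by rewrite ltnS leq_div.
rewrite (bigD1 (Ordinal nm))//= divnK// eqxx big1 ?addr0// => k kn.
rewrite ifF//; apply: contraNF kn => /eqP nk; apply/eqP/val_inj => /=.
by rewrite -(mulnK k m0) -nk.
Qed.

Lemma formal_resolventE I (A : gmx R I I) n : formal_resolvent A n = gpow A n.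
Proof. by rewrite /formal_resolvent neumann_mono// dvd1n divn1. Qed.

Lemma fps_pow_small I (Y : fps R I I) k n :
  Y 0%N = @gzero R I I -> (n < k)%N -> fps_pow Y k n = @gzero R I I.
Proof.
move=> Y0; elim: k n => // k IH n nk; apply: gmxP => i j.
rewrite (_ : fps_pow Y k.+1 n = fps_mul Y (fps_pow Y k) n)// /fps_mul.
rewrite big1// => -[[|l] ln] _; rewrite [nat_of_ord _]/=; first by rewrite Y0 gmul0.
by rewrite IH ?gmul_zero//; lia.
Qed.

Lemma neumann0 I (Y : fps R I I) : neumann Y 0 = @gone R I.
Proof. by apply: gmxP => i j; rewrite /neumann big_ord1. Qed.

(** The equation N = I + Y N, which determines the Neumann series N of Y
    coefficient by coefficient. *)
Lemma neumannS I (Y : fps R I I) n i j :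
  Y 0%N = @gzero R I I -> (forall l, row_finite (Y l)) ->
  neumann Y n.+1 i j = \sum_(l < n.+1) gmul (Y l.+1) (neumann Y (n - l)%N) i j.
Proof.
move=> Y0 fY; have gz x y : @gzero R I I x y = 0 by [].
rewrite [LHS]/neumann big_ord_recl /= add0r.
under eq_bigr => k _.
  rewrite [fps_mul _ _ _ _ _]big_ord_recl/= Y0 gmul0 gz add0r.
  over.
rewrite exchange_big /=; apply: eq_bigr => l _; rewrite subSS.
rewrite /bump /= add1n.
rewrite (_ : neumann Y (n - l)%N = fun x y => \sum_(k < n.+1) fps_pow Y k (n - l)%N x y).
  by rewrite gmul_sumr.
apply: gmxP => x y; rewrite /neumann.
rewrite (big_ord_widen n.+1 (fun k => fps_pow Y k (n - l)%N x y)); last first.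
  by rewrite ltnS leq_subr.
rewrite big_mkcond; apply: eq_bigr => k _; case: ifPn => //.
by rewrite -leqNgt => kn; rewrite fps_pow_small.
Qed.

End GeneralMatrices.

(** * Schur complements of formal resolvents *)

Section SchurComplement.
Variable R : realType.
Local Notation C := R[i].

Lemma row_finite_reindex (I' I : Type) (J' J : choiceType) (g : I' -> I)
    (h : J' -> J) (A : gmx R I J) :
  injective h -> row_finite A -> row_finite (fun i j => A (g i) (h j)).
Proof.
move=> hinj fA i; have [s sA] := fA (g i); have [s' hs] := seq_preimage s hinj.
by exists s' => j js; apply: sA; apply: contra js; exact: hs.
Qed.

Lemma gmul_embed (I K : Type) (J J' : choiceType) (h : J' -> J)
    (A : gmx R I J) (B : gmx R J K) i k :
  injective h -> (forall j, (forall j', h j' <> j) -> A i j * B j k = 0) ->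
  gmul A B i k = gmul (fun i j' => A i (h j')) (fun j' k => B (h j') k) i k.
Proof. by move=> hinj AB0; exact: fsum_embed. Qed.

Section Split.
Variables (I V W : choiceType) (v : V -> I) (w : W -> I).
Hypothesis vinj : injective v.
Hypothesis winj : injective w.
Hypothesis vw_disj : forall a b, v a <> w b.
Hypothesis vw_cover : forall i, (exists a, v a = i) \/ (exists b, w b = i).

Lemma gmul_split (H K : Type) (A : gmx R H I) (B : gmx R I K) x y :
  row_finite A ->
  gmul A B x y = gmul (fun x a => A x (v a)) (fun a y => B (v a) y) x y
               + gmul (fun x b => A x (w b)) (fun b y => B (w b) y) x y.
Proof.
move=> /(row_finite_uniq x)[s us sA].
pose inV i := `[< exists a, v a = i >].
pose A1 : gmx R H I := fun x i => if inV i then A x i else 0.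
pose A2 : gmx R H I := fun x i => if inV i then 0 else A x i.
have s1 i : i \notin s -> A1 x i = 0 by rewrite /A1 => /sA ->; case: ifP.
have s2 i : i \notin s -> A2 x i = 0 by rewrite /A2 => /sA ->; case: ifP.
have -> : gmul A B x y = gmul A1 B x y + gmul A2 B x y.
  rewrite (gmul_seq _ _ us sA) (gmul_seq _ _ us s1) (gmul_seq _ _ us s2).
  rewrite -big_split; apply: eq_bigr => i _; rewrite /A1 /A2.
  by rewrite /=; case: ifP; rewrite ?mul0r ?addr0 ?add0r.
congr (_ + _).
  rewrite [LHS](gmul_embed (h := v))// => [|i iN]; last first.
    by rewrite /A1 ifF ?mul0r//; apply/asboolP => -[a /iN].
  apply: eq_gmul => // a; rewrite /A1 ifT//.
  by apply/asboolP; exists a.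
rewrite [LHS](gmul_embed (h := w))// => [|i iN]; last first.
  rewrite /A2 ifT ?mul0r//; apply/asboolP.
  by have [//|[b /iN]] := vw_cover i.
apply: eq_gmul => // b; rewrite /A2 ifF//.
by apply/asboolP => -[a]; exact: vw_disj.
Qed.

Variable X : gmx R I I.
Hypothesis fX : row_finite X.

Let A : gmx R V V := fun a a' => X (v a) (v a').
Let B : gmx R V W := fun a b => X (v a) (w b).
Let D : gmx R W V := fun b a => X (w b) (v a).
Let X' : gmx R W W := fun b b' => X (w b) (w b').
Let Phi n : gmx R V V := fun a a' => gpow X n (v a) (v a').
Let Theta n : gmx R W V := fun b a => gpow X n (w b) (v a).

Let fA : row_finite A. Proof. exact: row_finite_reindex. Qed.
Let fB : row_finite B. Proof. exact: row_finite_reindex. Qed.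
Let fD : row_finite D. Proof. exact: row_finite_reindex. Qed.
Let fX' : row_finite X'. Proof. exact: row_finite_reindex. Qed.

Let PhiS n a a' :
  Phi n.+1 a a' = gmul A (Phi n) a a' + gmul B (Theta n) a a'.
Proof. exact: (gmul_split (gpow X n) (v a) (v a') fX). Qed.

Let ThetaS n b a :
  Theta n.+1 b a = gmul D (Phi n) b a + gmul X' (Theta n) b a.
Proof. exact: (gmul_split (gpow X n) (w b) (v a) fX). Qed.

(* A path from W to V is cut at the moment when it enters V for the first time. *)
Let ThetaE n b a : Theta n b a
  = \sum_(k < n) gmul (gpow X' k) (gmul D (Phi (n - k.+1)%N)) b a.
Proof.
elim: n b a => [|n IH] b a.
  rewrite big_ord0 [LHS](_ : _ = (w b == v a)%:R)//.
  by rewrite eq_sym (introF eqP (@vw_disj a b)).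
rewrite ThetaS big_ord_recl gmul1 subn1; congr (_ + _).
have -> : Theta n = fun b a =>
    \sum_(k < n) gmul (gpow X' k) (gmul D (Phi (n - k.+1)%N)) b a.
  by apply: gmxP => b' a'; exact: IH.
rewrite gmul_sumr//; apply: eq_bigr => k _.
by rewrite gmulA//; exact: row_finite_pow.
Qed.

(** Block elimination for formal resolvents.  A path that starts in V makes a first
    step inside V or to W; in the latter case it wanders in W, then enters V
    again, and continues from there.  This is the recursion satisfied by the
    Neumann series on the right-hand side. *)
Lemma schur_complement n a a' :
  gpow X n (v a) (v a')
  = neumann (fps_add (fps_mono 1 A) (fps_mul (fps_mono 2 B)
      (fps_mul (gpow X') (fps_mono 0 D)))) n a a'.
Proof.
set Y := fps_add _ _.
have YE l : Y l = fun a a' => fps_mono 1 A l a a' +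
    (if (2 <= l)%N then gmul B (gmul (gpow X' (l - 2)) D) a a' else 0).
  apply: gmxP => x y; congr (_ + _); rewrite /fps_mul/=.
  case: ifP => l2; last first.
    rewrite big1// => -[k kl] _/=; rewrite /fps_mono ifF ?gmul0//.
    by apply/eqP => k2; move: kl l2; rewrite k2 ltnS => ->.
  rewrite (bigD1 (Ordinal (l2 : (2 < l.+1)%N)))//= big1 ?addr0 => [|[k kl] k2].
    rewrite /fps_mono/=; apply: eq_gmul => // x'.
    rewrite (bigD1 ord_max)//= subnn eqxx big1 ?addr0// => -[k kl] /= km.
    rewrite ifF ?gmul_zero//; apply: contraNF km => kk.
    by apply/eqP/val_inj => /=; move: kl kk; lia.
  rewrite /fps_mono ifF ?gmul0//; apply: contraNF k2 => /= /eqP kk.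
  by apply/eqP/val_inj.
have Y0 : Y 0%N = @gzero R V V by rewrite YE; apply: gmxP => x y; rewrite /= addr0.
have fY l : row_finite (Y l).
  rewrite YE => x; have fBD : row_finite (gmul B (gmul (gpow X' (l - 2)) D)).
    by do 2!apply: row_finite_mul => //; exact: row_finite_pow.
  have [s sA] := fA x; have [t tB] := fBD x; exists (s ++ t) => y.
  rewrite mem_cat negb_or => /andP[/sA ys /tB yt]; rewrite yt /fps_mono.
  by case: ifP => _; rewrite ?ys; case: ifP; rewrite addr0.
have [m nm] := ubnP n; elim: m n nm a a' => // m IH [|n] nm a a'.
  rewrite neumann0 /= /gone; congr (_ : bool)%:R.
  by apply/eqP/eqP => [/vinj|->].
have {}IH k : (k <= n)%N -> Phi k = neumann Y k.
  by move=> kn; apply: gmxP => x y; apply: IH; lia.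
rewrite neumannS// -/(Phi n.+1 a a') PhiS big_ord_recl; congr (_ + _).
  rewrite subn0 IH// YE; apply: eq_gmul => // x.
  by rewrite /= addr0.
have -> : Theta n = fun b a =>
    \sum_(k < n) gmul (gpow X' k) (gmul D (Phi (n - k.+1)%N)) b a.
  by apply: gmxP => b' x; exact: ThetaE.
rewrite gmul_sumr//; apply: eq_bigr => k _.
rewrite YE /= /bump /= add1n IH ?leq_subr//.
have fk : row_finite (gpow X' k) by exact: row_finite_pow.
rewrite (gmulA _ fk fD) gmulA//; last exact: row_finite_mul.
apply: eq_gmul => // y; rewrite subSS subn1 /=.
by rewrite /fps_mono/= add0r.
Qed.

End Split.
End SchurComplement.

(** * Heights and positions *)

Lemma iter_ordS n (j : 'I_n) k : iter k (@ordS n) j = ((j + k) %% n)%N :> nat.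
Proof.
elim: k => [|k IH]; first by rewrite addn0 modn_small.
by rewrite iterS /= IH addnS -addn1 modnDml addn1.
Qed.

Section Heights.
Variables p q : nat.
Hypothesis hp : (1 <= p)%N.
Hypothesis hq : (1 <= q)%N.
Local Notation P := (PP p q).
Local Notation Q := (QQ p q).
Local Notation N := (RR p q).
Local Notation d := (dd p q).
Local Notation M := (p + q)%N.

Lemma dd_gt0 : (0 < d)%N. Proof. by rewrite gcdn_gt0 hp. Qed.
Lemma PP_dd : (P * d)%N = p. Proof. exact/divnK/dvdn_gcdl. Qed.
Lemma QQ_dd : (Q * d)%N = q. Proof. exact/divnK/dvdn_gcdr. Qed.
Lemma RR_dd : (N * d)%N = M. Proof. by rewrite mulnDl PP_dd QQ_dd. Qed.
Lemma PP_gt0 : (0 < P)%N.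
Proof. by move: hp; rewrite -{1}PP_dd muln_gt0 => /andP[]. Qed.
Lemma QQ_gt0 : (0 < Q)%N.
Proof. by move: hq; rewrite -{1}QQ_dd muln_gt0 => /andP[]. Qed.
Lemma RR_gt0 : (0 < N)%N. Proof. by rewrite addn_gt0 PP_gt0. Qed.
Lemma M_gt0 : (0 < M)%N. Proof. by rewrite addn_gt0 hp. Qed.
Hint Resolve dd_gt0 PP_gt0 QQ_gt0 RR_gt0 M_gt0 : core.

Lemma coprime_RR_QQ : coprime N Q.
Proof.
rewrite /coprime /RR gcdnC gcdnDr gcdnC; apply/eqP.
have := PP_dd; have := QQ_dd => eq ep.
apply/eqP; rewrite -(eqn_pmul2r dd_gt0) muln_gcdl ep eq mul1n.
by rewrite /dd.
Qed.

Lemma rem_lt k : (rem p q k < N)%N. Proof. exact: ltn_pmod. Qed.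

Lemma rem0 : rem p q 0 = 0%N. Proof. by rewrite /rem mul0n mod0n. Qed.

(** The carry modulo N = P + Q happens exactly at the letters U. *)
Lemma remS k :
  rem p q k.+1 = (if rem p q k < P then rem p q k + Q else rem p q k - P)%N.
Proof.
rewrite /rem mulSn addnC -modnDml; have := ltn_pmod (k * Q) RR_gt0.
set r := (_ %% _)%N; rewrite {1}/RR => rN; case: ifP => rP.
  by rewrite modn_small// /RR ltn_add2r.
have -> : (r + Q = r - P + N)%N by rewrite /RR; lia.
by rewrite modnDr modn_small// /RR; lia.
Qed.

(** The residues have period N and N divides M, so the last position is followed
    by the first one without any exception. *)
Lemma rem_ordS (j : 'I_M) : rem p q (ordS j) = rem p q j.+1.
Proof.
rewrite /rem (_ : nat_of_ord (ordS j) = (j.+1 %% M)%N)//.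
have [jM|] := ltnP j.+1 M; first by rewrite [(_ %% M)%N]modn_small.
rewrite leq_eqVlt => /orP[/eqP jM|]; last by rewrite ltnNge ltn_ord.
by rewrite -jM modnn mul0n mod0n -RR_dd -mulnA modnMr.
Qed.

Lemma hvalidE h (j : 'I_M) : hvalid (h, j) = (rem p q j == h %% N)%N.
Proof.
rewrite /hvalid /=; apply/andP/eqP => [[le_rh /dvdnP[k hk]]|rj].
  by rewrite -(subnK le_rh) hk modnMDl modn_small// rem_lt.
by rewrite rj leq_mod; split=> //; rewrite [X in (X - _)%N](divn_eq h N) addnK dvdn_mull.
Qed.

Lemma coord_at_subproof (j : 'I_M) n : hvalid ((rem p q j + n * N)%N, j).
Proof. by rewrite hvalidE [(_ + _ * _)%N]addnC modnMDl modn_small// rem_lt. Qed.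

Definition coord_at (j : 'I_M) (n : nat) : hidx p q :=
  @exist _ (fun x => hvalid x) _ (coord_at_subproof j n).

Lemma hpos_coord_at j n : hpos (coord_at j n) = j. Proof. by []. Qed.

Lemma height_coord_at j n : height (coord_at j n) = (rem p q j + n * N)%N.
Proof. by []. Qed.

Lemma hnum_coord_at j n : hnum (coord_at j n) = n.
Proof. by rewrite /hnum height_coord_at hpos_coord_at addKn mulnK. Qed.

Lemma heightE (x : hidx p q) : height x = (rem p q (hpos x) + hnum x * N)%N.
Proof.
by have /andP[hj /divnK hk] := valP x; rewrite /hnum hk subnKC.
Qed.

Lemma coord_atK x : coord_at (hpos x) (hnum x) = x.
Proof.
apply: val_inj; rewrite [LHS](_ : _ = (rem p q (hpos x) + hnum x * N, hpos x)%N)//.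
by rewrite -heightE [RHS]surjective_pairing.
Qed.

Lemma coord_at_inj j : injective (coord_at j).
Proof. by move=> m n /(congr1 (@hnum _ _)); rewrite !hnum_coord_at. Qed.

Lemma hidx_eq (x y : hidx p q) : (x == y) = (hpos x == hpos y) && (hnum x == hnum y).
Proof.
apply/eqP/andP => [->|[/eqP e1 /eqP e2]]; first by rewrite !eqxx.
by rewrite -(coord_atK x) -(coord_atK y) e1 e2.
Qed.

End Heights.

(** * The height-ordered matrix as a cyclic block shift *)

Section Refactorization.
Variable R : realType.

Lemma row_finite_lower (A : gmx R nat nat) : pos_lower A -> row_finite A.
Proof.
case=> _ _ A0 n; exists [:: n; n.-1] => m; rewrite !inE negb_or => /andP[mn mn1].
apply: A0; first by rewrite eq_sym.
by apply: contra mn1 => /eqP ->.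
Qed.

Lemma row_finite_upper (A : gmx R nat nat) : pos_upper A -> row_finite A.
Proof.
case=> _ _ A0 n; exists [:: n; n.+1] => m; rewrite !inE negb_or eq_sym => /andP[].
exact: A0.
Qed.

Lemma gprod_cat_ext (s1 s2 s2' : seq (gmx R nat nat)) :
  gprod s2 = gprod s2' -> gprod (s1 ++ s2) = gprod (s1 ++ s2').
Proof. by move=> e; elim: s1 => //= A s1 ->. Qed.

Lemma gprod_cat (I : choiceType) (s1 s2 : seq (gmx R I I)) :
  (forall A, List.In A s1 -> row_finite A) ->
  gprod (s1 ++ s2) = gmul (gprod s1) (gprod s2).
Proof.
elim: s1 => [|A s1 IH] fs /=; first by rewrite gmul1.
have fA : row_finite A by apply: fs; left.
have {}fs B : List.In B s1 -> row_finite B by move=> ?; apply: fs; right.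
have fp : row_finite (gprod s1).
  elim: s1 fs {IH} => [|B s1 IH] fs /=; first exact: row_finite_one.
  by apply: row_finite_mul; [apply: fs; left|apply: IH => D sD; apply: fs; right].
by rewrite IH// gmulA.
Qed.

Lemma UL_step_gprod s s' : UL_step s s' -> gprod s = gprod (s' : seq (gmx R nat nat)).
Proof.
case=> s1 s2 U L L' U' hU hL hL' hU' /gmxP ULE; apply: gprod_cat_ext => /=.
have [fU fL] := (row_finite_upper hU, row_finite_lower hL).
have [fU' fL'] := (row_finite_upper hU', row_finite_lower hL').
by rewrite !gmulA// ULE.
Qed.

Lemma UL_steps_gprod s s' : UL_steps s s' -> gprod s = gprod (s' : seq (gmx R nat nat)).
Proof. by elim=> // {}s' s'' _ -> /UL_step_gprod. Qed.

End Refactorization.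

Section CyclicShift.
Variables (R : realType) (p q : nat).
Hypothesis hp : (1 <= p)%N.
Hypothesis hq : (1 <= q)%N.
Variable Ft : seq (gmx R nat nat).
Hypothesis hFt : has_type_word (sigma_min p q) Ft.
Local Notation C := R[i].
Local Notation P := (PP p q).
Local Notation Q := (QQ p q).
Local Notation N := (RR p q).
Local Notation M := (p + q)%N.
Local Notation coord_at := (coord_at hp).
Local Notation F j := (nth (@gzero R nat nat) Ft (nat_of_ord j)).
Local Notation H := (Hmx p q Ft).
Let N0 : (0 < N)%N := RR_gt0 q hp.

Lemma sigma_minE (j : 'I_M) : nth false (sigma_min p q) j = (rem p q j < P)%N.
Proof. by rewrite (nth_map 0%N) ?size_iota// nth_iota. Qed.

Lemma size_Ft : size Ft = M.
Proof. by case: hFt => -> _; rewrite size_map size_iota. Qed.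

Lemma of_type_Ft (j : 'I_M) : of_type (rem p q j < P)%N (F j).
Proof.
by case: hFt => _ /(_ j); rewrite size_map size_iota => /(_ (ltn_ord j)); rewrite sigma_minE.
Qed.

Lemma row_finite_Ft (j : 'I_M) : row_finite (F j).
Proof.
have := of_type_Ft j; rewrite /of_type; case: ifP => _.
  exact: row_finite_lower.
exact: row_finite_upper.
Qed.

(** The heights are chosen for this: the displacements +Q and -P reproduce the two
    diagonals of the factor at position j, whether it is lower or upper. *)
Lemma Hmx_coord_at (j : 'I_M) n y :
  H (coord_at j n) y = if hpos y == ordS j then F j n (hnum y) else 0.
Proof.
rewrite /Hmx hpos_coord_at hnum_coord_at; case: (eqVneq (hpos y) (ordS j)) => [jy|//] /=.
rewrite sigma_minE height_coord_at (heightE y) jy rem_ordS remS//.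
have NE : N = (P + Q)%N by [].
have := of_type_Ft j; rewrite /of_type; move: (hnum y) => m; case: ifP => rP.
  case=> F1 _ F0.
  have -> : (rem p q j + Q + m * N == rem p q j + n * N + Q)%N = (m == n).
    by rewrite addnAC eqn_add2r eqn_add2l eqn_pmul2r.
  have -> : (rem p q j + Q + m * N + P == rem p q j + n * N)%N = (m.+1 == n).
    rewrite [LHS](_ : _ = (rem p q j + m.+1 * N == rem p q j + n * N)%N).
      by rewrite eqn_add2l eqn_pmul2r.
    by congr (_ == _); rewrite mulSn NE; lia.
  case: eqVneq => [->|mn]; first by rewrite F1.
  by case: eqVneq => [<-//|mn1]; rewrite F0// eq_sym.
case=> _ F1 F0.
have -> : (rem p q j - P + m * N == rem p q j + n * N + Q)%N = (m == n.+1).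
  rewrite [LHS](_ : _ = (rem p q j + m * N == rem p q j + n.+1 * N)%N).
    by rewrite eqn_add2l eqn_pmul2r.
  by rewrite mulSn NE; lia.
have -> : (rem p q j - P + m * N + P == rem p q j + n * N)%N = (m == n).
  rewrite [LHS](_ : _ = (rem p q j + m * N == rem p q j + n * N)%N).
    by rewrite eqn_add2l eqn_pmul2r.
  by lia.
case: eqVneq => [->|mn1]; first by rewrite F1.
by case: eqVneq => [->//|mn]; rewrite F0// eq_sym.
Qed.

Lemma row_finite_Hmx : row_finite H.
Proof.
move=> x; have [s sF] := row_finite_Ft (hpos x) (hnum x).
exists [seq coord_at (ordS (hpos x)) m | m <- s] => y ys.
rewrite -(coord_atK hp x) Hmx_coord_at; case: eqP => // jy; apply: sF.
by apply: contra ys => ys; apply/mapP; exists (hnum y) => //; rewrite -jy coord_atK.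
Qed.

Lemma gmul_Hmx (K : Type) (B : gmx R (hidx p q) K) (j : 'I_M) n k :
  gmul H B (coord_at j n) k = gmul (F j) (fun m k => B (coord_at (ordS j) m) k) n k.
Proof.
rewrite (gmul_embed (h := coord_at (ordS j))); first last.
- move=> y yN; rewrite Hmx_coord_at; case: eqP => [jy|]; last by rewrite mul0r.
  by case: (yN (hnum y)); rewrite -jy coord_atK.
- exact: coord_at_inj.
rewrite /gmul; apply: eq_fsbigr => m _; congr (_ * _).
by rewrite Hmx_coord_at hpos_coord_at eqxx hnum_coord_at.
Qed.

(** Powers of a cyclic block shift are products of consecutive blocks. *)
Lemma gpow_Hmx k (j : 'I_M) n y :
  gpow H k (coord_at j n) y =
  if hpos y == iter k (@ordS M) j
  then gprod [seq F i | i <- traject (@ordS M) j k] n (hnum y) else 0.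
Proof.
elim: k j n => [|k IH] j n.
  rewrite /= /gone (hidx_eq hp) hpos_coord_at hnum_coord_at eq_sym.
  by case: eqP => //= _; rewrite eq_sym.
rewrite (_ : gpow H k.+1 _ _ = gmul H (gpow H k) (coord_at j n) y)// gmul_Hmx /gmul.
under eq_fsbigr do rewrite IH.
rewrite -iterSr; case: ifP => // _; apply: fsbig1 => m _; rewrite mulr0//.
Qed.

Let j0 : 'I_M := Ordinal (M_gt0 q hp).

Lemma traject_Ft : [seq F i | i <- traject (@ordS M) j0 M] = Ft.
Proof.
apply: (@eq_from_nth _ (@gzero R nat nat)); rewrite size_map size_traject ?size_Ft//.
move=> l lM; rewrite (nth_map j0) ?size_traject// nth_traject//.
by rewrite iter_ordS add0n modn_small.
Qed.

(** One turn of the cycle multiplies by the product of all factors. *)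
Lemma gpow_Hmx_cycle n i k :
  gpow H (M * n) (coord_at j0 i) (coord_at j0 k) = gpow (gprod Ft) n i k.
Proof.
have trM := traject_Ft.
have itM : iter M (@ordS M) j0 = j0 by apply: val_inj; rewrite /= iter_ordS add0n modnn.
rewrite gpow_Hmx hpos_coord_at hnum_coord_at.
have -> : iter (M * n) (@ordS M) j0 = j0.
  by apply: val_inj; rewrite /= iter_ordS add0n mulnC modnMl.
rewrite eqxx; congr (_ i k); elim: n => [|n IH]; first by rewrite muln0.
rewrite mulnS trajectD itM map_cat gprod_cat ?IH ?trM//.
rewrite -trM => A; elim: (traject (@ordS M) j0 M) => //= l s IHs [<-|/IHs//].
exact: row_finite_Ft.
Qed.

Lemma gpow_Hmx_off n i k : ~~ (M %| n)%N -> gpow H n (coord_at j0 i) (coord_at j0 k) = 0.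
Proof.
move=> Mn; rewrite gpow_Hmx hpos_coord_at ifF//; apply: contraNF Mn => /eqP/(congr1 val)/=.
by rewrite iter_ordS add0n => /esym/eqP.
Qed.

Lemma Ra_mul (K : Type) (B : gmx R (hidx p q) K) n k :
  gmul (@Ra p q R) B n k = B (coord_at j0 n) k.
Proof.
have RaE x : @Ra p q R n x = (x == coord_at j0 n)%:R by rewrite /Ra (hidx_eq hp) hpos_coord_at hnum_coord_at.
rewrite /gmul (fsum_single (i0 := coord_at j0 n)) => [|x /negPf xn].
  by rewrite RaE eqxx mul1r.
by rewrite RaE xn mul0r.
Qed.

Lemma mul_Ra_tr (I : Type) (B : gmx R I (hidx p q)) x n :
  gmul B (gtr (@Ra p q R)) x n = B x (coord_at j0 n).
Proof.
rewrite -[RHS](Ra_mul (gtr B) n x) /gmul.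
by apply: eq_fsbigr => y _; rewrite mulrC.
Qed.

Lemma formal_projection_Hmx : formal_projection H (gprod Ft).
Proof.
move=> n i k; rewrite Ra_mul mul_Ra_tr formal_resolventE neumann_mono ?M_gt0//.
case: ifP => Mn; last by rewrite gpow_Hmx_off ?Mn.
by rewrite -gpow_Hmx_cycle mulnC divnK.
Qed.

End CyclicShift.

(** * The two height displacements *)

Section HeightBlocks.
Variables p q : nat.
Hypothesis hp : (1 <= p)%N.
Hypothesis hq : (1 <= q)%N.
Local Notation P := (PP p q).
Local Notation Q := (QQ p q).
Local Notation N := (RR p q).
Local Notation d := (dd p q).
Local Notation M := (p + q)%N.
Let N_gt0 : (0 < N)%N := RR_gt0 q hp.

Lemma QQ_inverse : exists b, (b * Q = 1 %[mod N])%N.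
Proof.
case: (Bezoutl Q N_gt0) => a _; have /eqP -> := coprime_RR_QQ q hp => aN.
(* a Q = -1 modulo N, and N - 1 stands for -1. *)
exists (N.-1 * a)%N; apply/eqP; rewrite -(eqn_modDr (a * Q)).
rewrite -mulnA -mulSnr prednK// modnMr eq_sym.
exact: aN.
Qed.

(** Multiplying by the inverse b of Q modulo N turns the condition r_j = h
    modulo N into a condition on j modulo N alone. *)
Lemma hvalid_residue : exists b, forall h (j : 'I_M),
  hvalid (h, j) = (j %% N == (b * h) %% N)%N.
Proof.
have [b bQ] := QQ_inverse; exists b => h j; rewrite hvalidE// /rem.
apply/eqP/eqP => [jh|jh]; last first.
  by rewrite -modnMml jh modnMml mulnAC -modnMml bQ modnMml mul1n.
by rewrite -[RHS]modnMmr -jh modnMmr mulnCA mulnC -modnMml bQ modnMml mul1n.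
Qed.

(** The M = d N positions meet each residue class modulo N exactly d times. *)
Lemma card_coords h : #|{: coords p q h}| = d.
Proof.
have [b hvE] := hvalid_residue; set x := ((b * h) %% N)%N.
have gM (i : 'I_d) : (i * N + x < M)%N.
  rewrite -(RR_dd p q) [(N * d)%N]mulnC; apply: (@leq_trans (i.+1 * N)); last first.
    by rewrite leq_mul2r ltn_ord orbT.
  by rewrite mulSn addnC ltn_add2r ltn_pmod.
pose g (i : 'I_d) : 'I_M := Ordinal (gM i).
rewrite card_sig -[RHS]card_ord -(@card_codom _ _ g); last first.
  move=> i k /(congr1 val)/= /eqP.
  by rewrite eqn_add2r eqn_pmul2r// => /eqP/val_inj.
apply: eq_card => j; rewrite inE hvE; apply/eqP/codomP => [jx|[i ->]]; last first.
  by rewrite /= modnMDl modn_mod.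
have jd : (j %/ N < d)%N by rewrite ltn_divLR// mulnC (RR_dd p q).
by exists (Ordinal jd); apply: val_inj; rewrite /= /x -jx -divn_eq.
Qed.

Lemma hvalid_ordS h h' (j : 'I_M) :
  (h' = h + Q %[mod N])%N -> hvalid (h', ordS j) = hvalid (h, j).
Proof.
move=> hh'; rewrite !hvalidE// rem_ordS /rem hh' mulSn addnC.
by rewrite eqn_modDr.
Qed.

Lemma coords_next h h' (x : coords p q h) : (h' = h + Q %[mod N])%N ->
  exists y : coords p q h', val y = ordS (val x).
Proof.
move=> hh'; have hy : hvalid (h', ordS (val x)) by rewrite (hvalid_ordS _ hh') (valP x).
by exists (exist _ (ordS (val x)) hy).
Qed.

Lemma coords_prev h h' (y : coords p q h') : (h' = h + Q %[mod N])%N ->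
  exists x : coords p q h, val y = ordS (val x).
Proof.
move=> hh'; have yK : ordS (ord_pred (val y)) = val y by rewrite ord_predK.
have hx : hvalid (h, ord_pred (val y)) by rewrite -(hvalid_ordS _ hh') yK (valP y).
by exists (exist _ (ord_pred (val y)) hx).
Qed.

Lemma height_coord h (x : coords p q h) : height (coord_hidx x) = h. Proof. by []. Qed.

Lemma hpos_coord h (x : coords p q h) : hpos (coord_hidx x) = val x. Proof. by []. Qed.

Variables (R : realType) (Ft : seq (gmx R nat nat)).
Hypothesis hFt : has_type_word (sigma_min p q) Ft.
Local Notation H := (Hmx p q Ft).

Lemma hblock_up h (x : coords p q h) (y : coords p q (h + Q)) :
  H (coord_hidx x) (coord_hidx y) = (val y == ordS (val x))%:R.
Proof.
rewrite /Hmx !hpos_coord !height_coord eqxx.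
by case: eqP.
Qed.

(** For a lower factor the entry at n = 0 is absent from the matrix; it does not
    occur from height P on, because a position with letter L and n = 0 has height
    r_j < P. *)
Lemma hblock_down h (x : coords p q h) (y : coords p q (h - P)) : (P <= h)%N ->
  if val y == ordS (val x) then is_true (0 < H (coord_hidx x) (coord_hidx y))
  else H (coord_hidx x) (coord_hidx y) = 0.
Proof.
move=> Ph; rewrite /Hmx !hpos_coord !height_coord subnK// eqxx.
case: eqP => //= _.
rewrite sigma_minE ifF; last by have := QQ_gt0 p hq; lia.
have := of_type_Ft hFt (val x); rewrite /of_type; case: ifP => xP [] F1 F2 _; last exact: F1.
have n1 : (1 <= hnum (coord_hidx x))%N.
  have /= := heightE (coord_hidx x); rewrite height_coord hpos_coord.
  by case: (hnum _) => // hx; move: xP; rewrite mul0n addn0 in hx; rewrite -hx ltnNge Ph.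
by rewrite n1 -{1}(prednK n1).
Qed.

Lemma hblock_other h h' (x : coords p q h) (y : coords p q h') :
  h' <> (h + Q)%N -> h <> (h' + P)%N -> H (coord_hidx x) (coord_hidx y) = 0.
Proof.
move=> /eqP/negPf hQ /eqP; rewrite eq_sym => /negPf hP.
by rewrite /Hmx !height_coord hQ hP; case: ifP.
Qed.

Lemma two_displacements_Hmx : two_displacements H.
Proof.
exists card_coords; split=> [h|h Ph|h h' hQ hP]; last first.
- by apply/matrixP => i k; rewrite !mxE hblock_other.
(* Both displacements lead to the same residue since P + Q = N. *)
- have hh' : (h - P = h + Q %[mod N])%N.
    by rewrite -[LHS]modnDl; congr (_ %% _)%N; move: Ph; rewrite /RR; lia.
  have key i k : let y := enum_val k in let x := enum_val i in
      if val y == ordS (val x) then is_true (0 < hblock H h (h - P)%N i k)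
      else hblock H h (h - P)%N i k = 0.
    by move=> y x; rewrite mxE; exact: hblock_down.
  have neq0 i k : hblock H h (h - P) i k != 0 -> val (enum_val k) = ordS (val (enum_val i)).
    by have /= := key i k; case: (_ =P _) => // _ ->; rewrite eqxx.
  split=> [i|k|i k].
  + have [y yx] := coords_next (enum_val i) hh'; exists (enum_rank y); split.
      have /= := key i (enum_rank y); rewrite enum_rankK yx eqxx => /lt0r_neq0.
      by [].
    by move=> k /neq0 kx; apply/(canLR (@enum_valK _))/val_inj; rewrite yx kx.
  + have [x yx] := coords_prev (enum_val k) hh'; exists (enum_rank x); split.
      have /= := key (enum_rank x) k; rewrite enum_rankK yx eqxx => /lt0r_neq0.
      by [].
    move=> i /neq0 ki; apply/(canLR (@enum_valK _))/val_inj.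
    by apply: (bij_inj (ordS_bij _)); rewrite -yx ki.
  + by have /= := key i k; case: (_ =P _) => // _ ->; rewrite eqxx.
pose nxt i := sval (cid (coords_next
  (enum_val (cast_ord (esym (card_coords h)) i)) (erefl ((h + Q) %% N)%N))).
have nxtE i : val (nxt i) = ordS (val (enum_val (cast_ord (esym (card_coords h)) i))).
  by rewrite /nxt; case: cid.
pose f i := cast_ord (card_coords (h + Q)) (enum_rank (nxt i)).
have finj : injective f.
  move=> i k /cast_ord_inj/enum_rank_inj ik.
  have := congr1 val ik; rewrite !nxtE => /(bij_inj (ordS_bij _))/val_inj/enum_val_inj.
  exact: cast_ord_inj.
apply/is_perm_mxP; exists (perm.perm finj); apply/matrixP => i k.
rewrite castmxE !mxE hblock_up perm.permE -nxtE; congr (_ : bool)%:R.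
rewrite -[in RHS](cast_ordKV (card_coords (h + Q)) k) /f.
rewrite (inj_eq (@cast_ord_inj _ _ _)) -[in RHS](enum_valK (cast_ord _ k)).
by rewrite (inj_eq enum_rank_inj) eq_sym (inj_eq val_inj).
Qed.

End HeightBlocks.

(** * Projection of the operator resolvent *)

Section SequenceSpaces.
Variable R : realType.
Local Notation C := R[i].

Lemma in_l_embed (I J : choiceType) (h : J -> I) (e : \bar R) (x : I -> C) :
  (1 <= e)%E -> injective h -> in_l e x -> in_l e (x \o h).
Proof.
rewrite /in_l /lnorm => e1 hinj; case: e e1 => [r| |]//.
  rewrite lee_fin => r1.
  have r0 : r^-1 != 0 by rewrite invr_neq0// gt_eqF// (lt_le_trans ltr01).
  move/(lty_poweRy r0) => xoo; apply: poweR_lty; apply: le_lt_trans xoo.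
  rewrite -(@esum_image _ _ _ setT h (fun i => ((complex.Re `|x i|) `^ r)%:E)).
    rewrite esum_mkcond; apply: le_esum => i _; case: ifP => // _.
    by rewrite lee_fin powR_ge0.
  by move=> a b _ _; exact: hinj.
move=> _ xoo; apply: le_lt_trans xoo; apply: ereal_sup_le => _ [j _ <-].
by exists (h j).
Qed.

Lemma in_l_extend (I J : choiceType) (h : J -> I) (e : \bar R) (x : I -> C) :
  (1 <= e)%E -> injective h -> (forall i, (forall j, h j <> i) -> x i = 0) ->
  in_l e (x \o h) -> in_l e x.
Proof.
rewrite /in_l /lnorm => e1 hinj x0; case: e e1 => [r| |]//.
  rewrite lee_fin => r1; have rN0 : r != 0 by rewrite gt_eqF// (lt_le_trans ltr01).
  move=> /(lty_poweRy (invr_neq0 rN0)) xoo; apply: poweR_lty; apply: le_lt_trans xoo.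
  rewrite -(@esum_image _ _ _ setT h (fun i => ((complex.Re `|x i|) `^ r)%:E)); last first.
    by move=> a b _ _; exact: hinj.
  rewrite [leRHS]esum_mkcond; apply: le_esum => i _; case: ifPn => //.
  move=> /negP iN; rewrite x0 ?normr0 ?powR0// => j hj; apply: iN.
  by rewrite inE; exists j.
move=> _; set s := ereal_sup _ => xoo.
apply: (@le_lt_trans _ _ (maxe 0%E s)).
  apply: ge_ereal_sup => _ [i _ <-]; rewrite le_max.
  have [[j <-]|iN] := pselect (exists j, h j = i).
    by apply/orP; right; apply: ereal_sup_ubound; exists j.
  by rewrite x0 ?normr0 ?lexx// => j hj; apply: iN; exists j.
by rewrite gt_max xoo andbT ltry.
Qed.

Lemma lnorm_ge0 (I : choiceType) (i0 : I) (e : \bar R) (x : I -> C) :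
  (0 <= lnorm e x)%E.
Proof.
case: e => [r| |] //=; first exact: poweR_ge0.
apply: (@le_trans _ _ (complex.Re `|x i0|)%:E); last by apply: ereal_sup_ubound; exists i0.
by rewrite lee_fin; have := normr_ge0 (x i0); rewrite lecE => /andP[].
Qed.

(** The constant c in the bound may be negative, hence the detour through finite
    nonnegative norms, which needs a nonempty index set when e is infinite. *)
Lemma bounded_map_in_l (I J : choiceType) (j0 : J) (e : \bar R)
    (G : (J -> C) -> (I -> C)) x :
  bounded_map e G -> in_l e x -> in_l e (G x).
Proof.
move=> [c cG] xl; apply: le_lt_trans (cG x xl) _.
have : lnorm e x \is a fin_num by rewrite ge0_fin_numE// lnorm_ge0.
by move=> /fineK <-; rewrite -EFinM ltry.
Qed.

Lemma gapply_gmul (I : Type) (J : choiceType) (A : gmx R I J) (x : J -> C) i :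
  gapply A x i = gmul A (fun j (_ : unit) => x j) i tt.
Proof. by []. Qed.

Lemma gapply_mul (I : Type) (J K : choiceType) (A : gmx R I J) (B : gmx R J K) x i :
  row_finite A -> row_finite B -> gapply A (gapply B x) i = gapply (gmul A B) x i.
Proof.
by move=> fA fB; rewrite [RHS]gapply_gmul -gmulA.
Qed.

Lemma gapplyZ (I : Type) (J : choiceType) (A : gmx R I J) (c : C) x i :
  gapply A (fun j => c * x j) i = c * gapply A x i.
Proof.
by rewrite /gapply mulr_fsumr; apply: eq_fsbigr => j _; rewrite mulrCA.
Qed.

Lemma gapply1 (I : choiceType) (x : I -> C) : gapply (@gone R I) x = x.
Proof. by apply/funext => i; rewrite gapply_gmul gmul1. Qed.

End SequenceSpaces.

Section OperatorProjection.
Variables (R : realType) (p q : nat).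
Hypothesis hp : (1 <= p)%N.
Hypothesis hq : (1 <= q)%N.
Variable Ft : seq (gmx R nat nat).
Hypothesis hFt : has_type_word (sigma_min p q) Ft.
Local Notation C := R[i].
Local Notation M := (p + q)%N.
Local Notation coord_at := (coord_at hp).
Local Notation F j := (nth (@gzero R nat nat) Ft (nat_of_ord j)).
Local Notation H := (Hmx p q Ft).
Let j0 : 'I_M := Ordinal (M_gt0 q hp).

Lemma gapply_Hmx (x : hidx p q -> C) j n :
  gapply H x (coord_at j n) = gapply (F j) (fun m => x (coord_at (ordS j) m)) n.
Proof. by rewrite gapply_gmul gmul_Hmx. Qed.

Lemma gapply_Ra (x : hidx p q -> C) n : gapply (@Ra p q R) x n = x (coord_at j0 n).
Proof. by rewrite gapply_gmul Ra_mul. Qed.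

Lemma gapply_Ra_tr (y : nat -> C) j n :
  gapply (gtr (@Ra p q R)) y (coord_at j n) = if j == j0 then y n else 0.
Proof.
rewrite /gapply (fsum_single (i0 := n)) /gtr /Ra hpos_coord_at hnum_coord_at.
  by rewrite eqxx andbT [RHS](_ : _ = (j == j0)%:R * y n)//; case: eqP; rewrite ?mul1r ?mul0r.
by move=> m /negPf; rewrite eq_sym => ->; rewrite andbF mul0r.
Qed.

Lemma row_finite_traject j k :
  row_finite (gprod [seq F i | i <- traject (@ordS M) j k]).
Proof.
elim: k j => [|k IH] j /=; first exact: row_finite_one.
by apply: row_finite_mul => //; exact: row_finite_Ft.
Qed.

(** The equations at the other positions express each component x_j as t F_j
    x_(j+1); substituting them in turn into the equation at the first position
    goes once round the cycle. *)
Lemma cycle_elimination (t : C) (x : hidx p q -> C) (y : nat -> C) :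
  (forall z, x z - t * gapply H x z = gapply (gtr (@Ra p q R)) y z) ->
  forall n, x (coord_at j0 n)
    - t ^+ M * gapply (gprod Ft) (fun m => x (coord_at j0 m)) n = y n.
Proof.
move=> xE; pose c j m := x (coord_at j m).
have step j n : c j n = t * gapply (F j) (c (ordS j)) n + (if j == j0 then y n else 0).
  by rewrite -gapply_Ra_tr -xE gapply_Hmx addrC subrK.
(* Substitution along a stretch of k positions that avoids the first one. *)
have run k j : (forall i, (i < k)%N -> iter i (@ordS M) j != j0) -> forall n,
    c j n = t ^+ k * gapply (gprod [seq F i | i <- traject (@ordS M) j k])
                       (c (iter k (@ordS M) j)) n.
  elim: k j => [|k IH] j jN n; first by rewrite expr0 mul1r gapply1.
  rewrite step (negPf (jN 0%N _))// addr0.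
  rewrite (_ : c (ordS j) = fun n => t ^+ k * gapply (gprod [seq F i | i <-
      traject (@ordS M) (ordS j) k]) (c (iter k (@ordS M) (ordS j))) n); last first.
    by apply/funext => m; apply: IH => i ik; rewrite -iterSr; exact: jN.
  rewrite gapplyZ mulrA -exprS gapply_mul -?iterSr//; first exact: row_finite_Ft.
  exact: row_finite_traject.
move=> n; rewrite -/(c j0 n) step eqxx.
have -> : c (ordS j0) = fun n => t ^+ M.-1 * gapply (gprod [seq F i | i <-
      traject (@ordS M) (ordS j0) M.-1]) (c j0) n.
  apply/funext => m; rewrite (run M.-1) => [|i iM].
    rewrite -iterSr prednK ?M_gt0//; congr (_ * gapply _ (c _) m).
    by apply: val_inj; rewrite /= iter_ordS add0n modnn.
  rewrite -iterSr; apply/eqP => /(congr1 (@nat_of_ord M)).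
  by rewrite iter_ordS add0n modn_small// -(prednK (M_gt0 q hp)) ltnS.
rewrite gapplyZ mulrA -exprS prednK ?M_gt0// gapply_mul; last 2 first.
- exact: row_finite_Ft.
- exact: row_finite_traject.
have -> : gprod Ft = gprod [seq F i | i <- traject (@ordS M) j0 M.-1.+1].
  by rewrite prednK ?M_gt0// traject_Ft.
by rewrite addrAC subrr add0r.
Qed.

(** With x = (I - tH)^-1 Ra^T y, the first component x_1 lies in the sequence space
    and solves (I - t^M T) x_1 = y; applying the resolvent of T gives x_1. *)
Lemma operator_projection_Hmx : operator_projection H (gprod Ft).
Proof.
move=> e e1 _ _ t G S [Gb GH] [_ ST] y yl.
set y' := gapply (gtr (@Ra p q R)) y.
have y'l : in_l e y'.
  apply: (in_l_extend e1 (@coord_at_inj p q hp j0)) => [z zN|].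
    rewrite -(coord_atK hp z) /y' gapply_Ra_tr; case: eqP => // zj.
    by case: (zN (hnum z)); rewrite -zj coord_atK.
  rewrite (_ : y' \o coord_at j0 = y)//; apply/funext => n.
  by rewrite /= /y' gapply_Ra_tr eqxx.
have [_ GE] := GH y' y'l; set x := G y' in GE *.
have xl : in_l e x by apply: bounded_map_in_l Gb y'l; exact: (coord_at j0 0).
have xjl : in_l e (x \o coord_at j0) by apply: in_l_embed => //; exact: coord_at_inj.
have [SE _] := ST _ xjl.
move=> n; rewrite gapply_Ra -[LHS]SE; congr (S _ n); apply/funext => m.
exact: (cycle_elimination GE).
Qed.

End OperatorProjection.

(** * The height-block continued fraction *)

Section ContinuedFraction.
Variables (R : realType) (p q : nat).
Hypothesis hp : (1 <= p)%N.
Hypothesis hq : (1 <= q)%N.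
Variable Ft : seq (gmx R nat nat).
Hypothesis hFt : has_type_word (sigma_min p q) Ft.
Local Notation P := (PP p q).
Local Notation Q := (QQ p q).
Local Notation w := (width p q).
Local Notation H := (Hmx p q Ft).

Lemma Hmx_far x y :
  height y != (height x + Q)%N -> (height y + P)%N != height x -> H x y = 0.
Proof.
by move=> /negPf yQ /negPf yP; rewrite /Hmx yQ yP; case: ifP.
Qed.

(** Two heights that are separated by a whole block differ by more than
    w = max(P, Q). *)
Lemma Hmx_beyond m x y : (height x < m.+1 * w)%N -> (m.+2 * w <= height y)%N ->
  H x y = 0 /\ H y x = 0.
Proof.
have := leq_maxl P Q; have := leq_maxr P Q; rewrite -/w !mulSn => Qw Pw xm ym.
by split; apply: Hmx_far; apply/eqP; lia.
Qed.

Lemma block_tridiagonal_Hmx : block_tridiagonal H.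
Proof.
move=> m m' x y; have /andP[xl xr] := valP x; have /andP[yl yr] := valP y.
rewrite negb_and -!ltnNge => /orP[] mm.
  apply: (proj2 (Hmx_beyond yr _)); apply: leq_trans xl; by rewrite leq_mul2r mm orbT.
by apply: (proj1 (Hmx_beyond xr _)); apply: leq_trans yl; rewrite leq_mul2r mm orbT.
Qed.

Lemma tail_incl_subproof m (x : tail p q m.+1) : (m * w <= height (val x))%N.
Proof. by apply: leq_trans (valP x); rewrite leq_mul2r leqnSn orbT. Qed.

Definition tail_incl m (x : tail p q m.+1) : tail p q m :=
  exist _ (val x) (tail_incl_subproof x).

Lemma vblock_tail_inj m : injective (@vblock_tail p q m).
Proof. by move=> x y /(congr1 val)/= xy; exact: val_inj. Qed.

Lemma tail_incl_inj m : injective (@tail_incl m).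
Proof. by move=> x y /(congr1 val)/= xy; exact: val_inj. Qed.

Lemma vblock_tail_range m (x : tail p q m) :
  (forall y, @vblock_tail p q m y <> x) -> (m.+1 * w <= height (val x))%N.
Proof.
move=> xN; rewrite leqNgt; apply/negP => xm.
have hx : (m * w <= height (val x))%N && (height (val x) < m.+1 * w)%N.
  by rewrite xm andbT (valP x).
by apply: (xN (exist _ (val x) hx)); exact: val_inj.
Qed.

(** After block elimination, the couplings of V_m with the tail beyond it vanish
    outside V_(m+1), so that only the leading block of the resolvent of that tail
    remains. *)
Lemma continued_fraction_Hmx : continued_fraction H.
Proof.
move=> m n x y; rewrite {1}/Phi formal_resolventE.
have fX : row_finite (@tail_mx p q R H m).
  exact: (row_finite_reindex _ (@val_inj _ _ _) (row_finite_Hmx hp hq hFt)).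
rewrite (@schur_complement R _ _ _ (@vblock_tail p q m) (@tail_incl m)); first last.
- exact: fX.
- move=> z; have [zm|zm] := leqP (m.+1 * w) (height (val z)).
    by right; exists (exist _ (val z) zm); exact: val_inj.
  have hz : (m * w <= height (val z))%N && (height (val z) < m.+1 * w)%N.
    by rewrite zm andbT (valP z).
  by left; exists (exist _ (val z) hz); exact: val_inj.
- move=> a b ab; have /andP[_] := valP a.
  by rewrite ltnNge => /negP; apply; rewrite [val a](congr1 val ab); exact: valP b.
- exact: tail_incl_inj.
- exact: vblock_tail_inj.
congr (neumann _ n x y); apply/funext => l; apply: gmxP => a a'; congr (_ + _).
apply: eq_bigr => k _; rewrite (gmul_embed (h := @vblock_tail p q m.+1)); first last.
- move=> b bN; rewrite /fps_mono; case: ifP => _; last by rewrite mul0r.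
  have /andP[_ am] := valP a.
  rewrite [X in X * _](_ : _ = 0) ?mul0r//.
  exact: (proj1 (Hmx_beyond am (vblock_tail_range bN))).
- exact: vblock_tail_inj.
apply: eq_gmul => c; first by rewrite /fps_mono; case: ifP.
apply: eq_bigr => j _; rewrite (gmul_embed (h := @vblock_tail p q m.+1)); first last.
- move=> b bN; rewrite /fps_mono; case: ifP => _; last by rewrite mulr0.
  have /andP[_ am] := valP a'.
  rewrite [X in _ * X](_ : _ = 0) ?mulr0//.
  exact: (proj2 (Hmx_beyond am (vblock_tail_range bN))).
- exact: vblock_tail_inj.
rewrite /gmul; apply: eq_fsbigr => u _; congr (_ * _).
  by rewrite /Phi formal_resolventE.
by rewrite /fps_mono; case: ifP.
Qed.

End ContinuedFraction.

(** * Resolvents of cyclic shifts over rational functions *)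

HB.instance Definition _ (R : realType) :=
  GRing.RMorphism.copy (@ratC R) (@tofrac {poly R[i]} \o @polyC R[i]).

Section PolynomialMatrices.
Variable K : fieldType.

(** Each term of the determinant is a product of n polynomials of degree at most 1. *)
Lemma size_det_linear n (A : 'M[{poly K}]_n) :
  (forall i j, size (A i j) <= 2)%N -> (size (\det A) <= n.+1)%N.
Proof.
move=> A2; apply: leq_trans (size_sum _ _ _) _; apply/bigmax_leqP => s _.
rewrite size_Msign; apply: leq_trans (size_prod_leq _ _) _.
rewrite card_ord leq_subLR addnS ltnS.
rewrite (@leq_trans (\sum_(i < n) 2))//; first by apply: leq_sum.
by rewrite sum_nat_const card_ord muln2 addnn.
Qed.

Lemma size_char_poly_mx n (B : 'M[K]_n) i j : (size (char_poly_mx B i j) <= 2)%N.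
Proof.
rewrite !mxE; apply: leq_trans (size_polyD _ _) _; rewrite size_polyN geq_max.
apply/andP; split; last by rewrite (leq_trans (size_polyC_leq1 _)).
by case: eqP => _; rewrite ?size_polyX// mulr0n size_poly0.
Qed.

Lemma size_adj_char_poly_mx n (B : 'M[K]_n) i j :
  (size ((\adj (char_poly_mx B)) i j) <= n)%N.
Proof.
rewrite mxE /cofactor size_Msign; case: n => [|n] in B i j *; first by case: i.
by apply: size_det_linear => k l; rewrite 2!mxE size_char_poly_mx.
Qed.

End PolynomialMatrices.

Section CyclicResolvent.
Variables (R : realType) (M : nat).
Hypothesis M_gt0 : (0 < M)%N.
Local Notation C := R[i].
Local Notation F := (ratfun R).
Local Notation ratM := (map_mx (@ratC R)).
Local Notation t := (tau R).
Let z : F := t ^- M.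

(** Evaluation at z = tau^-M, as a ring morphism, carries statements on
    characteristic polynomials over to the field of rational functions of tau. *)
Definition at_z (f : {poly C}) : F := (map_poly (@ratC R) f).[z].

HB.instance Definition _ :=
  GRing.RMorphism.copy at_z (horner_eval z \o map_poly (@ratC R)).

Lemma at_zC c : at_z c%:P = ratC c.
Proof. by rewrite /at_z map_polyC hornerC. Qed.

Lemma at_zX : at_z 'X = z.
Proof. by rewrite /at_z map_polyX hornerX. Qed.

Lemma tau_neq0 : t != 0.
Proof. by rewrite tofrac_eq0 polyX_eq0. Qed.

Lemma z_neq0 : z != 0.
Proof. by rewrite invr_eq0 expf_neq0// tau_neq0. Qed.

Variable s : nat.

(** The determinant is a polynomial in tau that takes the value 1 at tau = 0. *)
Lemma unitmx_resolvent (B : 'M[C]_s) k : (0 < k)%N ->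
  1%:M - t ^+ k *: ratM B \in unitmx.
Proof.
move=> k0; rewrite unitmxE unitfE.
pose Y : 'M[{poly C}]_s := 1%:M - 'X^k *: map_mx polyC B.
have -> : 1%:M - t ^+ k *: ratM B = map_mx (@tofrac _) Y.
  by apply/matrixP => i j; rewrite !mxE rmorphB rmorphM rmorphXn rmorph_nat.
rewrite det_map_mx tofrac_eq0; apply/eqP => /(congr1 (horner_eval 0)).
rewrite rmorph0 -det_map_mx (_ : map_mx _ Y = 1%:M) ?det1.
  by move/eqP; rewrite oner_eq0.
apply/matrixP => i j; rewrite !mxE rmorphB rmorphM rmorphXn rmorph_nat/=.
by rewrite /horner_eval hornerX expr0n -[k == 0%N]negbK -lt0n k0 mul0r subr0.
Qed.

(** The geometric sum (1 - t A) (1 + t A + ... + (t A)^(M-1)) = 1 - (t A)^M. *)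
Lemma resolvent_geometric (A : 'M[C]_s) :
  invmx (1%:M - t *: ratM A) =
  (\sum_(i < M) t ^+ i *: ratM (A ^+ i)) *m invmx (1%:M - t ^+ M *: ratM (A ^+ M)).
Proof.
set X := t *: ratM A; set Y := 1%:M - t ^+ M *: _.
have XE i : t ^+ i *: ratM (A ^+ i) = X ^+ i.
  elim: i => [|i IH]; first by rewrite !expr0 scale1r map_mx1.
  rewrite !exprS -IH /X -[RHS]scalemxAl -scalemxAr scalerA; congr (_ *: _).
  exact: map_mxM.
have uX : 1%:M - X \in unitmx by have := unitmx_resolvent A (ltn0Sn 0); rewrite expr1.
have uY : Y \in unitmx by exact: unitmx_resolvent.
have geo : (1%:M - X) *m (\sum_(i < M) X ^+ i) = Y.
  rewrite /Y XE; apply: oppr_inj; rewrite opprB -mulNmx opprB.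
  by rewrite [RHS](subrX1 X).
under eq_bigr do rewrite XE.
by rewrite -[RHS](mulKmx uX) (mulmxA (1%:M - X)) geo mulmxV// mulmx1.
Qed.

Variable pos : 'I_s -> 'I_M.
Let D (j : 'I_M) : 'M[F]_s := diag_mx (\row_k (pos k == j)%:R).

(** Only the term i = 0 of the geometric sum contributes: A^i moves the first
    position to another one for 0 < i < M, while A^M, hence the resolvent of A^M,
    preserves positions.  The argument is carried out with the diagonal
    projections D j onto the positions. *)
Lemma cyclic_resolvent r1 r2 (j0 : 'I_M) (A : 'M[C]_s) (u : 'M[C]_(r1, s))
    (v : 'M[C]_(s, r2)) :
  (forall i k, A i k != 0 -> pos k = ordS (pos i)) ->
  (forall i k, u i k != 0 -> pos k = j0) ->
  (forall k i, v k i != 0 -> pos k = j0) ->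
  ratM u *m invmx (1%:M - t *: ratM A) *m ratM v
  = ratM u *m invmx (1%:M - t ^+ M *: ratM (A ^+ M)) *m ratM v.
Proof.
move=> Apos upos vpos.
have uD : ratM u *m D j0 = ratM u.
  apply/matrixP => i k; rewrite mul_mx_diag !mxE.
  have [->|/upos ->] := eqVneq (u i k) 0; first by rewrite rmorph0 mul0r.
  by rewrite eqxx mulr1.
have Dv : D j0 *m ratM v = ratM v.
  apply/matrixP => k i; rewrite mul_diag_mx !mxE.
  have [->|/vpos ->] := eqVneq (v k i) 0; first by rewrite rmorph0 mulr0.
  by rewrite eqxx mul1r.
have DA j : D j *m ratM A = ratM A *m D (ordS j).
  apply/matrixP => i k; rewrite mul_mx_diag mul_diag_mx !mxE.
  have [->|/Apos ->] := eqVneq (A i k) 0; first by rewrite rmorph0 mulr0 mul0r.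
  by rewrite (inj_eq (bij_inj (ordS_bij _))) mulrC.
have DAn n j : D j *m ratM (A ^+ n) = ratM (A ^+ n) *m D (iter n (@ordS M) j).
  elim: n j => [|n IH] j; first by rewrite expr0 map_mx1 mulmx1 mul1mx.
  by rewrite exprS map_mxM/= mulmxA DA -mulmxA IH mulmxA -iterSr.
set Y := 1%:M - t ^+ M *: _.
have uY : Y \in unitmx by exact: unitmx_resolvent.
have DY j : D j *m Y = Y *m D j.
  rewrite mulmxBr mulmxBl mulmx1 mul1mx -scalemxAr -scalemxAl DAn.
  congr (_ - _ *: (_ *m D _)); apply: val_inj.
  by rewrite /= iter_ordS modnDr modn_small.
have DYV j : D j *m invmx Y = invmx Y *m D j.
  by rewrite -[RHS]mulmx1 -(mulmxV uY) mulmxA -(mulmxA _ (D j)) DY mulmxA mulVmx// mul1mx.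
rewrite resolvent_geometric -/Y mulmx_suml mulmx_sumr mulmx_suml.
rewrite (bigD1 (Ordinal M_gt0))//= expr0 scale1r map_mx1 mul1mx.
rewrite big1 ?addr0// => k k0.
rewrite -scalemxAl -scalemxAr -scalemxAl -uD -!mulmxA (mulmxA (D j0)) DAn.
rewrite -(mulmxA (ratM (A ^+ k))) (mulmxA (D _)) DYV -mulmxA -Dv (mulmxA (D _)).
rewrite [D _ *m D _](_ : _ = 0) ?mul0mx ?mulmx0 ?scaler0//.
apply/matrixP => i l; rewrite mul_diag_mx !mxE.
have [->|_] := eqVneq (pos i) j0; last by rewrite mul0rn mulr0.
rewrite (_ : (j0 == iter k (@ordS M) j0) = false) ?mul0r//; apply/negP => /eqP jk.
have := iter_ordS j0 k; rewrite -jk => jkM.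
suff k00 : k = Ordinal M_gt0 by rewrite k00 eqxx in k0.
apply: val_inj => /=; have kM := ltn_ord k.
have : (j0 + k == j0 + 0 %[mod M])%N by rewrite addn0 [X in _ == X]modn_small// -jkM.
by rewrite eqn_modDl mod0n modn_small// => /eqP.
Qed.

(** Here z^-1 (1 - z^-1 B)^-1 = (z - B)^-1 = adj(z - B) / chi(z), with chi the
    characteristic polynomial of B.  Iterating (z - B)^-1 = z^-1 + z^-1 B
    (z - B)^-1 yields the remainder z^-K u B^K (z - B)^-1 v, a quotient of a
    polynomial of degree less than s by z^K chi(z). *)
Lemma resolvent_at_infinity r1 r2 (B : 'M[C]_s) (u : 'M[C]_(r1, s))
    (v : 'M[C]_(s, r2)) (K : nat) i j :
  exists a b : {poly C}, [/\ b != 0, (size a + K < size b)%N &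
    (z^-1 *: (ratM u *m invmx (1%:M - t ^+ M *: ratM B) *m ratM v)) i j
    - \sum_(n < K) z ^- n.+1 * ratC ((u *m B ^+ n *m v) i j) = at_z a / at_z b].
Proof.
set Y := 1%:M - _; have uY : Y \in unitmx by exact: unitmx_resolvent.
pose Z := map_mx at_z (char_poly_mx B).
have ZY : Z = z *: Y.
  rewrite scalerBr scalerA mulVf ?expf_neq0 ?tau_neq0// scale1r scalemx1.
  apply/matrixP => k l; rewrite !mxE rmorphB /= at_zC rmorphMn /= at_zX.
  by rewrite -mulr_natr.
have chiN0 : at_z (char_poly B) != 0.
  have dY : \det Y != 0 by move: uY; rewrite unitmxE unitfE.
  rewrite -[at_z _]det_map_mx -/Z ZY detZ.
  exact: mulf_neq0 (expf_neq0 _ z_neq0) dY.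
pose W := z^-1 *: invmx Y.
have ZW : Z *m W = 1%:M.
  by rewrite ZY /W -scalemxAl -scalemxAr scalerA (divff z_neq0) scale1r (mulmxV uY).
have WE : W = (at_z (char_poly B))^-1 *: map_mx at_z (\adj (char_poly_mx B)).
  have WZ : W *m Z = 1%:M by rewrite -(mulmx1C ZW).
  rewrite -[RHS]mul1mx -WZ -mulmxA -scalemxAr map_mx_adj mul_mx_adj det_map_mx.
  by rewrite -scalemx1 scalerA mulVf// scale1r mulmx1.
have Wrec : W = z^-1 *: (1%:M + ratM B *m W).
  have zB : Z = z%:M - ratM B.
    by apply/matrixP => k l; rewrite !mxE rmorphB /= at_zC rmorphMn /= at_zX.
  by rewrite -{1}ZW zB mulmxBl subrK mul_scalar_mx scalerA mulVf ?z_neq0// scale1r.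
have exp_step n (u' : 'M[C]_(r1, s)) : ratM u' *m W *m ratM v
    = (\sum_(k < n) z ^- k.+1 *: ratM (u' *m B ^+ k *m v))
      + z ^- n *: (ratM (u' *m B ^+ n) *m W *m ratM v).
  have BS k : B *m B ^+ k = B ^+ k.+1 by rewrite exprS.
  elim: n u' => [|n IH] u'.
    by rewrite big_ord0 add0r expr0 invr1 scale1r expr0 mulmx1.
  have uB : ratM u' *m ratM B = ratM (u' *m B) by rewrite map_mxM.
  rewrite {1}Wrec -scalemxAr -scalemxAl mulmxDr mulmx1 mulmxDl mulmxA uB.
  rewrite (IH (u' *m B)) big_ord_recl expr1 expr0 mulmx1 scalerDr -addrA.
  congr (_ + _); first by rewrite map_mxM.
  rewrite scalerDr scaler_sumr; congr (_ + _).
    apply: eq_bigr => k _; rewrite scalerA -invfM -exprS; congr (_ *: map_mx _ _).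
    by rewrite -(mulmxA u') BS.
  by rewrite scalerA -invfM -exprS -(mulmxA u') BS.
exists ((map_mx polyC (u *m B ^+ K) *m \adj (char_poly_mx B) *m map_mx polyC v) i j).
exists ('X^K * char_poly B); split.
- by rewrite mulf_neq0 ?expf_neq0 ?polyX_eq0// monic_neq0// char_poly_monic.
- rewrite mulrC size_mulXn ?monic_neq0 ?char_poly_monic// size_char_poly addnC.
  rewrite addnS ltnS leq_add2l mxE; apply: leq_trans (size_sum _ _ _) _.
  apply/bigmax_leqP => k _; rewrite mulrC [X in X * _]mxE mul_polyC.
  apply: leq_trans (size_scale_leq _ _) _; rewrite mxE.
  apply: leq_trans (size_sum _ _ _) _; apply/bigmax_leqP => l _.
  rewrite [X in X * _]mxE mul_polyC; apply: leq_trans (size_scale_leq _ _) _.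
  exact: size_adj_char_poly_mx.
- have -> : z^-1 *: (ratM u *m invmx Y *m ratM v) = ratM u *m W *m ratM v.
    by rewrite /W -scalemxAr -scalemxAl.
  rewrite (exp_step K) mxE summxE.
  under eq_bigr do rewrite 2!mxE.
  rewrite addrC addrK rmorphM rmorphXn /= at_zX invfM mulrCA.
  rewrite mxE WE -scalemxAr -scalemxAl mxE; congr (_ * _); rewrite mulrC; congr (_ / _).
  have polyCz m n (X : 'M[C]_(m, n)) : ratM X = map_mx at_z (map_mx polyC X).
    by apply/matrixP => k l; rewrite !mxE at_zC.
  by rewrite !polyCz -!map_mxM mxE.
Qed.

End CyclicResolvent.

(** * Rational approximants *)

Section RationalApproximation.
Variables (R : realType) (p q : nat).
Hypothesis hp : (1 <= p)%N.
Hypothesis hq : (1 <= q)%N.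
Variable Ft : seq (gmx R nat nat).
Hypothesis hFt : has_type_word (sigma_min p q) Ft.
Local Notation C := R[i].
Local Notation P := (PP p q).
Local Notation Q := (QQ p q).
Local Notation w := (width p q).
Local Notation M := (p + q)%N.
Local Notation coord_at := (coord_at hp).
Local Notation H := (Hmx p q Ft).
Let j0 : 'I_M := Ordinal (M_gt0 q hp).

Section Truncation.
Variable N : nat.
Local Notation s := #|{: trunc p q N}|.
Local Notation A := (trunc_mx H N).

Definition tcoord (k : 'I_s) : hidx p q := trunc_hidx (enum_val k).

Lemma tcoord_inj : injective tcoord.
Proof.
move=> k l /(congr1 val)/= [] hkl pkl; apply: enum_val_inj; apply: val_inj.
by rewrite [LHS]surjective_pairing [RHS]surjective_pairing pkl; congr pair; exact: val_inj.
Qed.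

Lemma tcoord_range x : (height x < N.+1 * w)%N -> exists k, tcoord k = x.
Proof.
move=> xN; have hx : hvalid (Ordinal xN : nat, hpos x).
  by have := valP x; rewrite [val x]surjective_pairing.
exists (enum_rank (exist (fun y : 'I_(N.+1 * w) * 'I_M => hvalid (y.1 : nat, y.2))
  (Ordinal xN, hpos x) hx)).
by apply: val_inj; rewrite /= enum_rankK /= [RHS]surjective_pairing.
Qed.

Lemma Hmx_height x y : H x y != 0 -> (height y <= height x + Q)%N.
Proof.
move=> Hxy; rewrite leqNgt; apply: contra Hxy => xy; apply/eqP/Hmx_far => //.
  by rewrite neq_ltn xy orbT.
by apply/eqP; move: xy; lia.
Qed.

(** A path of n steps climbs by at most n Q, so it does not see the truncation when
    it starts far enough below the cut. *)
Lemma trunc_mx_pow n k l : (height (tcoord k) + n * Q < N.+1 * w)%N ->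
  (A ^+ n) k l = gpow H n (tcoord k) (tcoord l).
Proof.
elim: n k => [|n IH] k; first by rewrite expr0 mxE /= /gone (inj_eq tcoord_inj).
rewrite mulSn addnA => kN.
rewrite exprS mxE [RHS](_ : _ = gmul H (gpow H n) (tcoord k) (tcoord l))//.
rewrite (gmul_embed (h := tcoord)); first last.
- move=> y yN; have [->|/Hmx_height yk] := eqVneq (H (tcoord k) y) 0; first by rewrite mul0r.
  by case: (tcoord_range (x := y)) => [|i /yN//]; lia.
- exact: tcoord_inj.
rewrite /gmul (@fsum_seq _ _ (index_enum _)) ?index_enum_uniq// => [|i]; last first.
  by rewrite mem_index_enum.
apply: eq_bigr => i _; rewrite mxE.
have [->|/Hmx_height ik] := eqVneq (H (tcoord k) (tcoord i)) 0; first by rewrite !mul0r.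
by rewrite IH//; move: ik kN; rewrite /tcoord; lia.
Qed.

Lemma trunc_ERaE r (i : 'I_r) k :
  trunc_ERa p q R r N i k = (tcoord k == coord_at j0 i)%:R.
Proof.
rewrite mxE /gmul (fsum_single (i0 := nat_of_ord i)) => [|n /negPf ni].
  by rewrite /Eproj eqxx mul1r /Ra (hidx_eq hp) hpos_coord_at hnum_coord_at.
by rewrite /Eproj eq_sym ni mul0r.
Qed.

(** The coordinates selected by the projections have height at most
    M (P + Q), and n turns of the cycle climb by at most n M Q. *)
Lemma trunc_moment n (i : 'I_q) (j : 'I_p) :
  (M * RR p q + n.+1 * (M * Q) <= N)%N ->
  (trunc_ERa p q R q N *m A ^+ M ^+ n *m (trunc_ERa p q R p N)^T) i j
  = gpow (gprod Ft) n i j.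
Proof.
move=> nN; have w0 : (0 < w)%N by rewrite leq_max PP_gt0.
have NN : (N < N.+1 * w)%N by rewrite leq_pmulr.
have hgt (m : nat) : (m < M)%N -> (height (coord_at j0 m) + M * n * Q < N.+1 * w)%N.
  move=> mM; rewrite height_coord_at rem0 add0n; apply: leq_ltn_trans NN.
  apply: leq_trans nN; rewrite -mulnA [(n * Q)%N]mulnC mulnA mulSn [(M * Q * n)%N]mulnC.
  by rewrite leq_add ?leq_addl// leq_mul2r (ltnW mM) orbT.
have hi := hgt i (leq_trans (ltn_ord i) (leq_addl _ _)).
have hj := hgt j (leq_trans (ltn_ord j) (leq_addr _ _)).
case: (tcoord_range (leq_ltn_trans (leq_addr _ _) hi)) => k ki.
case: (tcoord_range (leq_ltn_trans (leq_addr _ _) hj)) => l lj.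
rewrite -exprM mxE (bigD1 l)//= big1 ?addr0 => [|l' ll]; last first.
  by rewrite [_^T _ _]mxE trunc_ERaE -lj (inj_eq tcoord_inj) (negPf ll) mulr0.
rewrite [_^T _ _]mxE trunc_ERaE lj eqxx mulr1 mxE (bigD1 k)//= big1 ?addr0 => [|k' kk].
  by rewrite trunc_ERaE ki eqxx mul1r trunc_mx_pow ki// lj gpow_Hmx_cycle.
by rewrite trunc_ERaE -ki (inj_eq tcoord_inj) (negPf kk) mul0r.
Qed.

Lemma trunc_mx_pos k l : A k l != 0 -> hpos (tcoord l) = ordS (hpos (tcoord k)).
Proof.
by rewrite mxE /Hmx -/(tcoord k) -/(tcoord l); case: (_ =P ordS _) => // _; rewrite eqxx.
Qed.

Lemma mul_trunc_ERa_pos r r' (X : 'M[C]_(r', r)) i k :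
  (X *m trunc_ERa p q R r N) i k != 0 -> hpos (tcoord k) = j0.
Proof.
apply: contra_neqP => kj; rewrite mxE big1// => l _; rewrite trunc_ERaE.
by case: eqP => [kE|]; [case: kj; rewrite kE|rewrite mulr0].
Qed.

End Truncation.

(** The order (N - M (P + Q)) / (M Q) is the largest number of moments that the bound of
    [trunc_moment] guarantees. *)
Lemma rational_approximation_Hmx : rational_approximation H (gprod Ft).
Proof.
move=> xi nu Psi [_ _ _ mom]; exists 0%N.
exists (fun N => (N - M * RR p q) %/ (M * Q))%N; split.
  have MQ : (0 < M * Q)%N by rewrite muln_gt0 M_gt0// QQ_gt0.
  apply/cvgnyPge => K; exists (K * (M * Q) + M * RR p q)%N => // N /= NK.
  by rewrite leq_divRL// leq_subRL; lia.
move=> N _ i j; set K := (_ %/ _)%N.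
set u := invmx xi *m trunc_ERa p q R q N.
set v := (trunc_ERa p q R p N)^T *m (invmx nu)^T.
set B := trunc_mx H N ^+ M.
have uBv n : (n < K)%N -> (u *m B ^+ n *m v) i j = moment (Psi i j) n.
  move=> nK; have := congr1 (fun X : 'M[C]_(q, p) => X i j) (mom n).
  rewrite [RHS]mxE => <-; rewrite /u /v -!mulmxA; congr ((_ *m _) i j).
  rewrite !mulmxA; congr (_ *m _); apply/matrixP => k l.
  have MQ : (0 < M * Q)%N by rewrite muln_gt0 M_gt0// QQ_gt0.
  rewrite trunc_moment; last first.
    have : (n.+1 * (M * Q) <= K * (M * Q))%N by rewrite leq_mul2r nK orbT.
    have := leq_trunc_div (N - M * RR p q) (M * Q); rewrite -/K.
    have : (0 < n.+1 * (M * Q))%N by rewrite muln_gt0.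
    lia.
  rewrite mxE /gmul (fsum_single (i0 := nat_of_ord k)) => [|m /negPf mk]; last first.
    by rewrite /Eproj eq_sym mk mul0r.
  rewrite {1}/Eproj eqxx mul1r (fsum_single (i0 := nat_of_ord l)) => [|m /negPf ml].
    by rewrite /gtr /Eproj eqxx mulr1.
  by rewrite /gtr /Eproj eq_sym ml mulr0.
have appE : approximant H xi nu N i j = ((zvar p q R)^-1 *: (map_mx (@ratC R) u
    *m invmx (1%:M - tau R ^+ M *: map_mx (@ratC R) B) *m map_mx (@ratC R) v)) i j.
  have upos k l : u k l != 0 -> hpos (tcoord l) = j0 by exact: mul_trunc_ERa_pos.
  have vpos k l : v k l != 0 -> hpos (tcoord k) = j0.
    rewrite /v -trmx_mul mxE; exact: mul_trunc_ERa_pos.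
  have cr := cyclic_resolvent (M_gt0 q hp) (@trunc_mx_pos N) upos vpos.
  exact: (congr1 (fun X : 'M[ratfun R]_(q, p) => ((zvar p q R)^-1 *: X) i j) cr).
have [a [b [b0 sab abE]]] := resolvent_at_infinity (M_gt0 q hp) B u v K i j.
exists a, b; split; [exact: b0|exact: sab|rewrite appE].
rewrite (eq_bigr (fun n : 'I_K => zvar p q R ^- n.+1 * ratC ((u *m B ^+ n *m v) i j))).
  exact: abE.
by move=> n _; rewrite uBv.
Qed.

End RationalApproximation.

(** * The corollary *)

Theorem corollary3p11 (R : realType) (p q : nat) (hp : (1 <= p)%N)
    (hq : (1 <= q)%N) (T : gmx R nat nat) (L U : nat -> gmx R nat nat)
    (hT : pos_bidiag_factorization p q T L U)
    (a : nat) (ha : A_cyc p q a) (Ft : seq (gmx R nat nat))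
    (hFt : min_height_refactorization p q L U a Ft) :
  let H := Hmx p q Ft in
  let Ta := T_cyc p q L U a in
  [/\ two_displacements H,
      formal_projection H Ta /\ operator_projection H Ta,
      block_tridiagonal H /\ continued_fraction H
    & rational_approximation H Ta].
Proof.
case: hFt => steps types H Ta; rewrite /Ta /T_cyc (UL_steps_gprod steps).
split.
- exact: two_displacements_Hmx.
- by split; [exact: formal_projection_Hmx|exact: operator_projection_Hmx].
- by split; [exact: block_tridiagonal_Hmx|exact: continued_fraction_Hmx].
- exact: rational_approximation_Hmx.
Qed.
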